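(* Let $f_{SN}:\widetilde{{}_{SN}\mathbb{R}^4_q}\to \mathcal{A}\otimes_\Psi \mathcal{I}$ be the map defined on generators by $$f_{SN}(\beta_{23})=x_{23}\otimes r,\qquad f_{SN}(\beta_{24})=x_{24}\otimes r,\qquad f_{SN}(r^{-1})=1\otimes r^{-1}$$ and extended as a $*$-algebra morphism. Then $f_{SN}$ is an isomorphism of unital $*$-algebras.
   Context: All algebras are complex; $q>0$ is a real parameter. **The algebra $\widetilde{{}_{SN}\mathbb{R}^4_q}$.** It is the unital $*$-algebra generated by $\beta_{13},\beta_{14},\beta_{23},\beta_{24},r^{-1}$ with relations $\beta_{13}\beta_{14}=\beta_{14}\beta_{13}$, $\beta_{23}\beta_{24}=\beta_{24}\beta_{23}$, $\beta_{13}\beta_{23}=q^2\beta_{23}\beta_{13}$, $\beta_{13}\beta_{24}=q^2\beta_{24}\beta_{13}$, $\beta_{14}\beta_{23}=q^2\beta_{23}\beta_{14}$, $\beta_{14}\beta_{24}=q^2\beta_{24}\beta_{14}$; $\beta_{13}r^{-1}=q^{-1}r^{-1}\beta_{13}$, $\beta_{14}r^{-1}=q^{-1}r^{-1}\beta_{14}$, $\beta_{23}r^{-1}=q\,r^{-1}\beta_{23}$, $\beta_{24}r^{-1}=q\,r^{-1}\beta_{24}$; and $r^{-2}(\beta_{13}\beta_{24}-\beta_{14}\beta_{23})=q=(\beta_{13}\beta_{24}-\beta_{14}\beta_{23})r^{-2}$, where $r^{-2}=(r^{-1})^2$. The $*$-structure is $\beta_{24}^*=q^{-1}\beta_{13}$,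 $\beta_{23}^*=-q^{-1}\beta_{14}$, $(r^{-1})^*=r^{-1}$. The element $r^{-1}$ is invertible, with inverse denoted $r$. **The algebra $\mathcal{A}$.** It is the commutative $*$-algebra $\mathcal{A}(SU(2))$ of coordinate functions on $SU(2)$, generated by $x_{23},x_{24},x_{23}^*,x_{24}^*$ with $x_{23}^*x_{23}+x_{24}^*x_{24}=1$. It is realized as the $*$-subalgebra of $\widetilde{{}_{SN}\mathbb{R}^4_q}$ generated by $x_{23}=\beta_{23}r^{-1}$ and $x_{24}=\beta_{24}r^{-1}$. **The algebra $\mathcal{I}$.** It is the commutative $*$-algebra generated by $r,r^{-1}$ with $rr^{-1}=r^{-1}r=1$ and $r^*=r$. **The twisted tensor product $\mathcal{A}\otimes_\Psi\mathcal{I}$.** It is the vector space $\mathcal{A}\otimes\mathcal{I}$ with multiplication $(m_{\mathcal{A}}\otimes m_{\mathcal{I}})(\mathrm{id}_{\mathcal{A}}\otimes\Psi\otimes\mathrm{id}_{\mathcal{I}})$, where $\Psi:\mathcal{I}\otimes\mathcal{A}\to\mathcal{A}\otimes\mathcal{I}$ is the linear map $$\Psi\big(r^{\pm n}\otimes x_{23}^a(x_{23}^* )^b x_{24}^c(x_{24}^* )^d\big)=q^{\pm n(a+c)\mp n(b+d)}\,x_{23}^a(x_{23}^* )^b x_{24}^c(x_{24}^* )^d\otimes r^{\pm n}$$ for all integers $n,a,b,c,d\ge 0$. Its unit is $1\otimes 1$ and its involution is $(x\otimes j)^{*_\Psi}=\Psi(j^*\otimes x^* )$ for $x\in\mathcal{A}$,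 $j\in\mathcal{I}$. *)

(* Defs.v *)
From HB Require Import structures.
From mathcomp Require Import all_boot all_order all_algebra.
From mathcomp Require Import boolp functions reals interval_inference complex ring zify.

Set Implicit Arguments.
Unset Strict Implicit.
Unset Printing Implicit Defensive.

Import Order.TTheory GRing.Theory Num.Theory.

Local Open Scope ring_scope.
Local Open Scope complex_scope.

#[local] Arguments conjc : simpl never.

HB.mixin Record Algebra_isStarAlgebra (R : realType) A
    of GRing.Algebra R[i] A := {
  star : A -> A;
  starD : forall x y : A, star (x + y) = star x + star y;
  starZ : forall (c : R[i]) (x : A), star (c *: x) = c^* *: star x;
  starM : forall x y : A, star (x * y) = star y * star x;
  starK : forall x : A, star (star x) = x
}.

#[short(type="starAlgType")]
HB.structure Definition StarAlgebra (R : realType) :=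
  {A of Algebra_isStarAlgebra R A & GRing.Algebra R[i] A}.

Definition star_preserving (R : realType) (A B : starAlgType R) (f : A -> B) :=
  forall x, f (star x) = star (f x).

(* The unital *-algebra presented by generators and relations: *-polynomial
   expressions in the generators modulo the least congruence that contains the
   axioms of a unital complex *-algebra and the given relations. *)

Inductive starTerm (R : realType) (X : Type) : Type :=
| Gen of X
| Scal of R[i]
| Add of starTerm R X & starTerm R X
| Mul of starTerm R X & starTerm R X
| Star of starTerm R X.

Arguments Gen {R X}.
Arguments Scal {R X}.

Declare Scope star_term_scope.
Delimit Scope star_term_scope with T.
Bind Scope star_term_scope with starTerm.
Notation "1" := (Scal 1%R) : star_term_scope.
Notation "s + t" := (Add s t) : star_term_scope.
Notation "s * t" := (Mul s t) : star_term_scope.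
Notation "c *: t" := (Mul (Scal c%R) t) : star_term_scope.
Notation "s - t" := (Add s (Mul (Scal (-1)%R) t)) : star_term_scope.
Notation "t ^*" := (Star t) : star_term_scope.

Inductive star_congr (R : realType) (X : Type)
    (rel : starTerm R X -> starTerm R X -> Prop) :
    starTerm R X -> starTerm R X -> Prop :=
| Congr_rel s t : rel s t -> star_congr rel s t
| Congr_refl t : star_congr rel t t
| Congr_sym s t : star_congr rel s t -> star_congr rel t s
| Congr_trans s t u :
    star_congr rel s t -> star_congr rel t u -> star_congr rel s u
| Congr_add s s' t t' : star_congr rel s s' -> star_congr rel t t' ->
    star_congr rel (s + t) (s' + t')
| Congr_mul s s' t t' : star_congr rel s s' -> star_congr rel t t' ->
    star_congr rel (s * t) (s' * t')
| Congr_star s s' : star_congr rel s s' -> star_congr rel (s^*) (s'^*)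
| Congr_addA s t u : star_congr rel (s + (t + u)) (s + t + u)
| Congr_addC s t : star_congr rel (s + t) (t + s)
| Congr_add0 t : star_congr rel (Scal 0 + t) t
| Congr_addN t : star_congr rel (t - t) (Scal 0)
| Congr_mulA s t u : star_congr rel (s * (t * u)) (s * t * u)
| Congr_mul1 t : star_congr rel (1 * t) t
| Congr_mulDl s t u : star_congr rel ((s + t) * u) (s * u + t * u)
| Congr_mulDr s t u : star_congr rel (s * (t + u)) (s * t + s * u)
| Congr_scalD c d : star_congr rel (Scal (c + d)%R) (Scal c + Scal d)
| Congr_scalM c d : star_congr rel (Scal (c * d)%R) (Scal c * Scal d)
| Congr_scalC c t : star_congr rel (Scal c * t) (t * Scal c)
| Congr_starD s t : star_congr rel ((s + t)^*) (s^* + t^*)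
| Congr_starM s t : star_congr rel ((s * t)^*) (t^* * s^*)
| Congr_starS c : star_congr rel ((Scal c)^*) (Scal (c^*)%C)
| Congr_starK t : star_congr rel (t^*^*) t.

(* Nontriviality is part of the data because [algType] requires 1 != 0. *)
Record presentation (R : realType) := Presentation {
  generator : Type;
  relation : starTerm R generator -> starTerm R generator -> Prop;
  nontrivial : ~ star_congr relation 1 (Scal 0)
}.

Section TermChoice.
Variables (R : realType) (X : Type).
HB.instance Definition _ := gen_eqMixin (starTerm R X).
HB.instance Definition _ := gen_choiceMixin (starTerm R X).
End TermChoice.

Section Presented.
Variables (R : realType) (P : presentation R).
Local Notation term := (starTerm R (generator P)).
Local Notation congr := (star_congr (@relation R P)).

Definition congr_bool : rel term := fun s t => `[< congr s t >].

Lemma congr_bool_equiv : equiv_class_of congr_bool.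
Proof.
split=> [t|s t|t s u].
- by apply/asboolP; constructor.
- by apply/asboolP/asboolP=> H; constructor.
- by move=> /asboolP H /asboolP H'; apply/asboolP; apply: Congr_trans H H'.
Qed.

Canonical congr_equiv := EquivRelPack congr_bool_equiv.

Definition presented : Type := {eq_quot congr_equiv}%qT.

HB.instance Definition _ := Choice.on presented.
HB.instance Definition _ := EqQuotient.on presented.

Definition pcls (t : term) : presented := (\pi_presented t)%qT.
Local Notation cls := pcls.

Lemma pclsP s t : cls s = cls t <-> congr s t.
Proof.
rewrite /pcls; split=> [/eqP|] H.
  by move: H; rewrite piE => /asboolP.
by apply/eqP; rewrite piE; apply/asboolP.
Qed.

Lemma pcls_repr (x : presented) : cls (repr x) = x.
Proof. exact: reprK. Qed.

Lemma repr_pcls t : congr (repr (cls t)) t.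
Proof. by apply/pclsP; rewrite pcls_repr. Qed.

Lemma pres_surj (x : presented) : exists t, x = cls t.
Proof. by exists (repr x); rewrite pcls_repr. Qed.

Definition padd (x y : presented) := cls (repr x + repr y).
Definition pmul (x y : presented) := cls (repr x * repr y).
Definition pscale (c : R[i]) (x : presented) := cls (c *: repr x).
Definition popp (x : presented) := pscale (-1) x.
Definition pstar (x : presented) := cls ((repr x)^*).

Let paddE s t : padd (cls s) (cls t) = cls (s + t).
Proof. by apply/pclsP; apply: Congr_add; apply: repr_pcls. Qed.
Let pmulE s t : pmul (cls s) (cls t) = cls (s * t).
Proof. by apply/pclsP; apply: Congr_mul; apply: repr_pcls. Qed.
Let pscaleE c t : pscale c (cls t) = cls (c *: t).
Proof.
by apply/pclsP; apply: Congr_mul; [apply: Congr_refl|apply: repr_pcls].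
Qed.
Let pstarE t : pstar (cls t) = cls (t^*).
Proof. by apply/pclsP; apply: Congr_star; apply: repr_pcls. Qed.
Let poppE t : popp (cls t) = cls ((-1) *: t).
Proof. exact: pscaleE. Qed.

Let pE := (paddE, pmulE, pscaleE, pstarE, poppE).

Local Ltac elim_presented :=
  intros;
  repeat match goal with x : presented |- _ =>
    let t := fresh "t" in let e := fresh "e" in
    have [t e] := pres_surj x; subst x end;
  rewrite ?pE; apply/pclsP.

Fact paddA : associative padd.
Proof. by move=> x y z; elim_presented; apply: Congr_addA. Qed.
Fact paddC : commutative padd.
Proof. by move=> x y; elim_presented; apply: Congr_addC. Qed.
Fact padd0 : left_id (cls (Scal 0)) padd.
Proof. by move=> x; elim_presented; apply: Congr_add0. Qed.
Fact paddN : left_inverse (cls (Scal 0)) popp padd.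
Proof. by move=> x; rewrite paddC; elim_presented; apply: Congr_addN. Qed.

HB.instance Definition _ :=
  GRing.isZmodule.Build presented paddA paddC padd0 paddN.

Fact pscaleA c d x : pscale c (pscale d x) = pscale (c * d) x.
Proof.
elim_presented; apply: Congr_trans (Congr_mulA _ _ _ _) _.
by apply: Congr_mul (Congr_refl _ _); apply/Congr_sym/Congr_scalM.
Qed.
Fact pscale1 : left_id 1 pscale.
Proof. by move=> x; elim_presented; apply: Congr_mul1. Qed.
Fact pscaleDr : right_distributive pscale +%R.
Proof.
by move=> c x y; rewrite /GRing.add /=; elim_presented; apply: Congr_mulDr.
Qed.
Fact pscaleDl x : {morph pscale^~ x : c d / c + d}.
Proof.
move=> c d; rewrite /GRing.add /=; elim_presented.
apply: Congr_trans _ (Congr_mulDl _ _ _ _).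
exact: Congr_mul (Congr_scalD _ _ _) (Congr_refl _ _).
Qed.

HB.instance Definition _ := GRing.Zmodule_isLmodule.Build R[i] presented
  pscaleA pscale1 pscaleDr pscaleDl.

Fact pmulA : associative pmul.
Proof. by move=> x y z; elim_presented; apply: Congr_mulA. Qed.
Fact pmul1 : left_id (cls 1) pmul.
Proof. by move=> x; elim_presented; apply: Congr_mul1. Qed.
Fact pmulr1 : right_id (cls 1) pmul.
Proof.
move=> x; elim_presented.
exact: Congr_trans (Congr_sym (Congr_scalC _ _ _)) (Congr_mul1 _ _).
Qed.
Fact pmulDl : left_distributive pmul +%R.
Proof.
by move=> x y z; rewrite /GRing.add /=; elim_presented; apply: Congr_mulDl.
Qed.
Fact pmulDr : right_distributive pmul +%R.
Proof.
by move=> x y z; rewrite /GRing.add /=; elim_presented; apply: Congr_mulDr.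
Qed.
Fact pone_neq0 : cls 1 != 0.
Proof. by apply/eqP => /pclsP; apply: nontrivial. Qed.

HB.instance Definition _ := GRing.Zmodule_isNzRing.Build presented
  pmulA pmul1 pmulr1 pmulDl pmulDr pone_neq0.

Fact pscaleAl (c : R[i]) (x y : presented) : c *: (x * y) = (c *: x) * y.
Proof.
by rewrite /GRing.scale /GRing.mul /=; elim_presented; apply: Congr_mulA.
Qed.

HB.instance Definition _ :=
  GRing.Lmodule_isLalgebra.Build R[i] presented pscaleAl.

Fact pscaleAr (c : R[i]) (x y : presented) : c *: (x * y) = x * (c *: y).
Proof.
rewrite /GRing.scale /GRing.mul /=; elim_presented.
apply: Congr_trans (Congr_mulA _ _ _ _) _.
apply: Congr_trans _ (Congr_sym (Congr_mulA _ _ _ _)).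
exact: Congr_mul (Congr_scalC _ _ _) (Congr_refl _ _).
Qed.

HB.instance Definition _ :=
  GRing.Lalgebra_isAlgebra.Build R[i] presented pscaleAr.

Fact pstarD (x y : presented) : pstar (x + y) = pstar x + pstar y.
Proof. by rewrite /GRing.add /=; elim_presented; apply: Congr_starD. Qed.
Fact pstarZ (c : R[i]) (x : presented) : pstar (c *: x) = c^* *: pstar x.
Proof.
rewrite /GRing.scale /=; elim_presented.
apply: Congr_trans (Congr_starM _ _ _) _.
apply: Congr_trans _ (Congr_sym (Congr_scalC _ _ _)).
exact: Congr_mul (Congr_refl _ _) (Congr_starS _ _).
Qed.
Fact pstarM (x y : presented) : pstar (x * y) = pstar y * pstar x.
Proof. by rewrite /GRing.mul /=; elim_presented; apply: Congr_starM. Qed.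
Fact pstarK (x : presented) : pstar (pstar x) = x.
Proof. by elim_presented; apply: Congr_starK. Qed.

HB.instance Definition _ :=
  Algebra_isStarAlgebra.Build R presented pstarD pstarZ pstarM pstarK.

Definition pgen (x : generator P) : presented := cls (Gen x).

Lemma pcls_Gen x : cls (Gen x) = pgen x. Proof. by []. Qed.
Lemma pcls_Add s t : cls (s + t) = cls s + cls t.
Proof. by rewrite -paddE. Qed.
Lemma pcls_Mul s t : cls (s * t) = cls s * cls t.
Proof. by rewrite -pmulE. Qed.
Lemma pcls_Star s : cls (s^*) = star (cls s).
Proof. by rewrite -pstarE. Qed.
Lemma pcls_Scal c : cls (Scal c) = c%:A.
Proof.
rewrite /GRing.scale /GRing.one /= pE; apply/pclsP; apply: Congr_sym.
exact: Congr_trans (Congr_scalC _ _ _) (Congr_mul1 _ _).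
Qed.
Definition pclsE := (pcls_Gen, pcls_Add, pcls_Mul, pcls_Star, pcls_Scal).

Lemma presented_ind (Q : presented -> Prop) :
  (forall x, Q (pgen x)) -> (forall c, Q (c%:A)) ->
  (forall x y, Q x -> Q y -> Q (x + y)) ->
  (forall x y, Q x -> Q y -> Q (x * y)) ->
  (forall x, Q x -> Q (star x)) -> forall x, Q x.
Proof.
move=> Qg Qc Qa Qm Qs x; have [t ->] := pres_surj x.
by elim: t => [y|c|s Hs t Ht|s Hs t Ht|s Hs]; rewrite pclsE; auto.
Qed.

End Presented.

(* Modules over a presented algebra.  [termact g b t] is the operator by which t
   (if b = false) or t^* (if b = true) acts when the generators act by
   [g false] and their adjoints by [g true]. *)
Section TermAction.
Variables (R : realType) (X : Type) (V : lmodType R[i]) (g : bool -> X -> V -> V).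

Fixpoint termact (b : bool) (t : starTerm R X) : V -> V :=
  match t with
  | Gen x => g b x
  | Scal c => *:%R (if b then c^* else c)
  | Add s t => fun v => termact b s v + termact b t v
  | Mul s t => if b then termact b t \o termact b s
               else termact b s \o termact b t
  | Star t => termact (~~ b) t
  end.

Hypothesis g_linear : forall b x, linear (g b x).

Lemma termact_linear t : forall b, linear (termact b t).
Proof.
elim: t => [x|c|s Hs t Ht|s Hs t Ht|s Hs] b a u v //=.
- exact: g_linear.
- by rewrite scalerDr !scalerA mulrC.
- by rewrite Hs Ht scalerDr addrACA.
- by case: b => /=; rewrite ?(Hs, Ht).
- exact: Hs.
Qed.

Lemma termactD b t u v : termact b t (u + v) = termact b t u + termact b t v.
Proof. by rewrite -[u]scale1r termact_linear !scale1r. Qed.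
Lemma termact0 b t : termact b t 0 = 0.
Proof.
by have := termact_linear t b (-1) 0 0; rewrite scaleN1r oppr0 addr0 scaleN1r addNr.
Qed.
Lemma termactZ b t c v : termact b t (c *: v) = c *: termact b t v.
Proof. by rewrite -[c *: v]addr0 termact_linear termact0 addr0. Qed.

Lemma termact_congr (rel : starTerm R X -> starTerm R X -> Prop) :
  (forall s t, rel s t -> forall b v, termact b s v = termact b t v) ->
  forall s t, star_congr rel s t -> forall b v, termact b s v = termact b t v.
Proof.
move=> relP s t; elim=> {s t} /=.
- exact: relP.
- by [].
- by move=> s t _ H b v; rewrite H.
- by move=> s t u _ H _ H' b v; rewrite H H'.
- by move=> s s' t t' _ H _ H' b v; rewrite H H'.
- by move=> s s' t t' _ H _ H' [] v /=; rewrite H H'.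
- by move=> s s' _ H b v.
- by move=> s t u b v; rewrite addrA.
- by move=> s t b v; rewrite addrC.
- by move=> t [] v /=; rewrite ?conjc0 scale0r add0r.
- by move=> t [] v /=; rewrite ?rmorphN ?rmorph1 ?termactZ scaleN1r subrr
    ?conjc0 scale0r.
- by move=> s t u [].
- by move=> t [] v /=; rewrite ?conjc1 scale1r.
- by move=> s t u [] v //=; rewrite termactD.
- by move=> s t u [] v //=; rewrite termactD.
- by move=> c d [] v /=; rewrite ?rmorphD scalerDl.
- by move=> c d [] v /=; rewrite scalerA ?rmorphM // mulrC.
- by move=> c t [] v /=; rewrite termactZ.
- by [].
- by move=> s t [].
- by move=> c [] v; rewrite /= ?conjcK.
- by move=> t b v; rewrite negbK.
Qed.

Lemma termact_comm :
  (forall b b' x y v, g b x (g b' y v) = g b' y (g b x v)) ->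
  forall s t b b' v,
  termact b s (termact b' t v) = termact b' t (termact b s v).
Proof.
move=> gC.
have gD b x u v : g b x (u + v) = g b x u + g b x v.
  by rewrite -[u]scale1r g_linear !scale1r.
have gZ b x c v : g b x (c *: v) = c *: g b x v.
  exact: (termactZ b (Gen x)).
have gact b x t : forall b' v,
    g b x (termact b' t v) = termact b' t (g b x v).
  elim: t => [y|c|s Hs t Ht|s Hs t Ht|s Hs] b' v //=.
  - by rewrite gD Hs Ht.
  - by case: b' => /=; rewrite ?Hs ?Ht ?Hs.
elim=> [y|c|s Hs t Ht|s Hs t Ht|s Hs] u b b' v /=.
- exact: gact.
- by rewrite termactZ.
- by rewrite Hs Ht termactD.
- by case: b => /=; rewrite ?Hs ?Ht ?Hs.
- exact: Hs.
Qed.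

Lemma termact_nontrivial (rel : starTerm R X -> starTerm R X -> Prop) (v : V) :
  (forall s t, rel s t -> forall b w, termact b s w = termact b t w) ->
  v != 0 -> ~ star_congr rel 1 (Scal 0).
Proof.
move=> relP /eqP v0 /(termact_congr relP) /(_ false v) /=.
by rewrite scale1r scale0r.
Qed.

End TermAction.

(* The tensor product U ⊗ V over K: formal sums of pairs (lists) modulo the
   relations making (u, v) |-> [:: (u, v)] bilinear. *)
Section TensorRel.
Variables (K : comNzRingType) (U V : lmodType K).

Inductive tens_congr : seq (U * V) -> seq (U * V) -> Prop :=
| Tens_refl s : tens_congr s s
| Tens_sym s t : tens_congr s t -> tens_congr t s
| Tens_trans s t w : tens_congr s t -> tens_congr t w -> tens_congr s w
| Tens_cat s s' t t' :
    tens_congr s s' -> tens_congr t t' -> tens_congr (s ++ t) (s' ++ t')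
| Tens_catC s t : tens_congr (s ++ t) (t ++ s)
| Tens_addl u u' v : tens_congr [:: (u + u', v)] [:: (u, v); (u', v)]
| Tens_addr u v v' : tens_congr [:: (u, v + v')] [:: (u, v); (u, v')]
| Tens_scale c u v : tens_congr [:: (c *: u, v)] [:: (u, c *: v)]
| Tens_zero v : tens_congr [:: (0, v)] [::].

Definition tens_congr_bool : rel (seq (U * V)) := fun s t => `[< tens_congr s t >].

Lemma tens_congr_equiv : equiv_class_of tens_congr_bool.
Proof.
split=> [t|s t|t s u].
- by apply/asboolP; constructor.
- by apply/asboolP/asboolP=> H; constructor.
- by move=> /asboolP H /asboolP H'; apply/asboolP; apply: Tens_trans H H'.
Qed.

Canonical tens_equiv := EquivRelPack tens_congr_equiv.

Definition tensor : Type := {eq_quot tens_equiv}%qT.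

HB.instance Definition _ := Choice.on tensor.
HB.instance Definition _ := EqQuotient.on tensor.

Definition tcls (s : seq (U * V)) : tensor := (\pi_tensor s)%qT.

Definition pure (u : U) (v : V) : tensor := tcls [:: (u, v)].

Lemma tclsP s t : tcls s = tcls t <-> tens_congr s t.
Proof.
rewrite /tcls; split=> [/eqP|] H.
  by move: H; rewrite piE => /asboolP.
by apply/eqP; rewrite piE; apply/asboolP.
Qed.

Lemma tcls_repr (x : tensor) : tcls (repr x) = x.
Proof. exact: reprK. Qed.

Lemma repr_tcls t : tens_congr (repr (tcls t)) t.
Proof. by apply/tclsP; rewrite tcls_repr. Qed.

Definition map_scale (c : K) (s : seq (U * V)) := [seq (c *: p.1, p.2) | p <- s].

Definition tadd (x y : tensor) := tcls (repr x ++ repr y).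
Definition tscale (c : K) (x : tensor) := tcls (map_scale c (repr x)).
Definition topp (x : tensor) := tscale (-1) x.

Lemma map_scale_congr c s t :
  tens_congr s t -> tens_congr (map_scale c s) (map_scale c t).
Proof.
rewrite /map_scale; elim=> {s t} /=.
- by move=> s; apply: Tens_refl.
- by move=> s t _; apply: Tens_sym.
- by move=> s t w _ H _; apply: Tens_trans H.
- by move=> s s' t t' _ H _ H'; rewrite !map_cat; apply: Tens_cat.
- by move=> s t; rewrite !map_cat; apply: Tens_catC.
- by move=> u u' v; rewrite scalerDr; apply: Tens_addl.
- by move=> u v v'; apply: Tens_addr.
- by move=> d u v; rewrite scalerA mulrC -scalerA; apply: Tens_scale.
- by move=> v; rewrite scaler0; apply: Tens_zero.
Qed.

Let taddE s t : tadd (tcls s) (tcls t) = tcls (s ++ t).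
Proof. by apply/tclsP; apply: Tens_cat; apply: repr_tcls. Qed.
Let tscaleE c s : tscale c (tcls s) = tcls (map_scale c s).
Proof. by apply/tclsP; apply: map_scale_congr; apply: repr_tcls. Qed.

Fact taddA : associative tadd.
Proof.
move=> x y z; rewrite -[x]tcls_repr -[y]tcls_repr -[z]tcls_repr.
by rewrite !taddE catA.
Qed.
Fact taddC : commutative tadd.
Proof.
move=> x y; rewrite -[x]tcls_repr -[y]tcls_repr !taddE.
by apply/tclsP; apply: Tens_catC.
Qed.
Fact tadd0 : left_id (tcls [::]) tadd.
Proof. by move=> x; rewrite -[x]tcls_repr taddE. Qed.
Fact taddN : left_inverse (tcls [::]) topp tadd.
Proof.
move=> x; rewrite -[x]tcls_repr /topp tscaleE taddE.
elim: (repr x) => [//|[u v] s IHs]; move: IHs.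
rewrite /= -cat1s -[(u, v) :: s]cat1s -!taddE => IHs.
have swap a b c d : tadd (tadd a b) (tadd c d) = tadd (tadd a c) (tadd b d).
  by rewrite -!taddA; congr tadd; rewrite !taddA; congr tadd; apply: taddC.
rewrite taddA swap IHs taddC tadd0 taddE /= scaleN1r.
apply/tclsP/(Tens_trans (Tens_sym (Tens_addl _ _ _))).
by rewrite addNr; apply: Tens_zero.
Qed.

HB.instance Definition _ := GRing.isZmodule.Build tensor taddA taddC tadd0 taddN.

Lemma tcls_cat s t : tcls (s ++ t) = tcls s + tcls t.
Proof. by rewrite -taddE. Qed.
Lemma tcls_sum s : tcls s = \sum_(p <- s) pure p.1 p.2.
Proof.
elim: s => [|p s IHs]; first by rewrite big_nil.
by rewrite big_cons -IHs -tcls_cat; case: p.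
Qed.

Fact tscaleA c d x : tscale c (tscale d x) = tscale (c * d) x.
Proof.
rewrite -[x]tcls_repr !tscaleE /map_scale -map_comp; congr tcls.
by apply: eq_map => p /=; rewrite scalerA.
Qed.
Fact tscale1 : left_id 1 tscale.
Proof.
move=> x; rewrite -[x]tcls_repr !tscaleE /map_scale; congr tcls.
by rewrite -[RHS]map_id; apply: eq_map => -[u v] /=; rewrite scale1r.
Qed.
Fact tscaleDr : right_distributive tscale +%R.
Proof.
move=> c x y; rewrite -[x]tcls_repr -[y]tcls_repr -tcls_cat !tscaleE.
by rewrite -tcls_cat /map_scale map_cat.
Qed.
Fact tscaleDl x : {morph tscale^~ x : c d / c + d}.
Proof.
move=> c d; rewrite -[x]tcls_repr !tscaleE !tcls_sum /map_scale !big_map.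
rewrite -big_split; apply: eq_bigr => -[u v] _ /=; rewrite scalerDl.
by rewrite -tcls_cat; apply/tclsP; apply: Tens_addl.
Qed.

HB.instance Definition _ := GRing.Zmodule_isLmodule.Build K tensor
  tscaleA tscale1 tscaleDr tscaleDl.

Lemma pureDl u u' v : pure (u + u') v = pure u v + pure u' v.
Proof. by rewrite -tcls_cat; apply/tclsP; apply: Tens_addl. Qed.
Lemma pureDr u v v' : pure u (v + v') = pure u v + pure u v'.
Proof. by rewrite -tcls_cat; apply/tclsP; apply: Tens_addr. Qed.
Lemma pureZl c u v : pure (c *: u) v = c *: pure u v.
Proof. by rewrite {2}/GRing.scale /= tscaleE. Qed.
Lemma pureZr c u v : pure u (c *: v) = c *: pure u v.
Proof. by rewrite -pureZl; apply/tclsP/Tens_sym/Tens_scale. Qed.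

Lemma tensor_ind (Q : tensor -> Prop) : Q 0 ->
  (forall u v x, Q x -> Q (pure u v + x)) -> forall x, Q x.
Proof.
move=> Q0 Qp x; rewrite -[x]tcls_repr tcls_sum.
by elim: (repr x) => [|p s IHs]; rewrite ?big_nil // big_cons; apply: Qp.
Qed.

(* The additive extension of a map b that is biadditive and balanced, such as
   a bilinear one; for other b the value is junk. *)
Definition tlift (W : zmodType) (b : U -> V -> W) (x : tensor) : W :=
  \sum_(p <- repr x) b p.1 p.2.

Section Lift.
Variables (W : zmodType) (b : U -> V -> W).
Hypothesis bDl : forall u u' v, b (u + u') v = b u v + b u' v.
Hypothesis bDr : forall u v v', b u (v + v') = b u v + b u v'.
Hypothesis bZ : forall c u v, b (c *: u) v = b u (c *: v).

Lemma tlift_tcls s : tlift b (tcls s) = \sum_(p <- s) b p.1 p.2.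
Proof.
have b0 v : b 0 v = 0.
  by apply: (@addrI _ (b 0 v)); rewrite -bDl !addr0.
rewrite /tlift; have := repr_tcls s; move: (repr _) => r.
elim=> {r s} //.
- by move=> s t w _ -> _ ->.
- by move=> s s' t t' _ e _ e'; rewrite !big_cat e e'.
- by move=> s t; rewrite !big_cat /= addrC.
- by move=> u u' v; rewrite !big_cons !big_nil /= !addr0 bDl.
- by move=> u v v'; rewrite !big_cons !big_nil /= !addr0 bDr.
- by move=> c u v; rewrite !big_cons !big_nil /= !addr0 bZ.
- by move=> v; rewrite !big_cons !big_nil /= addr0 b0.
Qed.

Lemma tlift_pure u v : tlift b (pure u v) = b u v.
Proof. by rewrite tlift_tcls big_cons big_nil addr0. Qed.

Lemma tliftD x y : tlift b (x + y) = tlift b x + tlift b y.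
Proof.
rewrite -[x]tcls_repr -[y]tcls_repr -tcls_cat !tlift_tcls.
by rewrite big_cat.
Qed.

Lemma tlift0 : tlift b 0 = 0.
Proof. by apply: (@addrI _ (tlift b 0)); rewrite -tliftD !addr0. Qed.

End Lift.
End TensorRel.

Section TensorLift.
Variables (K : comNzRingType) (U V W : lmodType K) (b : U -> V -> W).
Variable s : {rmorphism K -> K}.
Hypothesis bDl : forall u u' v, b (u + u') v = b u v + b u' v.
Hypothesis bDr : forall u v v', b u (v + v') = b u v + b u v'.
Hypothesis bZl : forall c u v, b (c *: u) v = s c *: b u v.
Hypothesis bZr : forall c u v, b u (c *: v) = s c *: b u v.

Let bZ c u v : b (c *: u) v = b u (c *: v).
Proof. by rewrite bZl bZr. Qed.

Lemma tliftZ c x : tlift b (c *: x) = s c *: tlift b x.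
Proof.
elim/tensor_ind: x => [|u v x IHx].
  by rewrite scaler0 (tlift0 bDl bDr bZ) scaler0.
rewrite scalerDr -pureZl !(tliftD bDl bDr bZ) !(tlift_pure bDl bDr bZ).
by rewrite IHx bZl scalerDr.
Qed.

End TensorLift.

Section Algebras.
Variable R : realType.

Inductive R4_gen := B13 | B14 | B23 | B24 | Rinv.

Section R4.
Variable q : R[i].
Local Notation b13 := (Gen B13).
Local Notation b14 := (Gen B14).
Local Notation b23 := (Gen B23).
Local Notation b24 := (Gen B24).
Local Notation rinv := (Gen Rinv).
Local Open Scope star_term_scope.

Inductive R4_rel : starTerm R R4_gen -> starTerm R R4_gen -> Prop :=
| R4_13_14 : R4_rel (b13 * b14) (b14 * b13)
| R4_23_24 : R4_rel (b23 * b24) (b24 * b23)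
| R4_13_23 : R4_rel (b13 * b23) (q ^+ 2 *: (b23 * b13))
| R4_13_24 : R4_rel (b13 * b24) (q ^+ 2 *: (b24 * b13))
| R4_14_23 : R4_rel (b14 * b23) (q ^+ 2 *: (b23 * b14))
| R4_14_24 : R4_rel (b14 * b24) (q ^+ 2 *: (b24 * b14))
| R4_13_r : R4_rel (b13 * rinv) (q^-1 *: (rinv * b13))
| R4_14_r : R4_rel (b14 * rinv) (q^-1 *: (rinv * b14))
| R4_23_r : R4_rel (b23 * rinv) (q *: (rinv * b23))
| R4_24_r : R4_rel (b24 * rinv) (q *: (rinv * b24))
| R4_detl : R4_rel (rinv * rinv * (b13 * b24 - b14 * b23)) (Scal q)
| R4_detr : R4_rel ((b13 * b24 - b14 * b23) * (rinv * rinv)) (Scal q)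
| R4_star24 : R4_rel (b24^*) (q^-1 *: b13)
| R4_star23 : R4_rel (b23^*) (- q^-1 *: b14)
| R4_starr : R4_rel (rinv^*) rinv.

(* The presented algebra acts nontrivially on functions Z -> C: b24 and b13 act as weighted
   shifts, b23 and b14 by zero. *)
Let R4_act (b : bool) (x : R4_gen) (v : int -> R[i]) : int -> R[i] :=
  let down c (n : int) : R[i] := (c * q ^ (n - 1) * v (n - 1))%R in
  let up c (n : int) : R[i] := (c * q * q ^ n * v (n + 1))%R in
  match x with
  | B13 => if b then down q else up 1%R
  | B24 => if b then up q^-1 else down 1%R
  | Rinv => fun n => (q ^ (- n) * v n)%R
  | _ => fun=> 0%R
  end.

Local Close Scope star_term_scope.

Hypotheses (q_neq0 : q != 0) (q_real : q^* = q).

Let fctD (u v : int -> R[i]) n : (u + v) n = u n + v n. Proof. by []. Qed.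
Let fctZ c (u : int -> R[i]) n : (c *: u) n = c * u n. Proof. by []. Qed.
Let fct0 n : (0 : int -> R[i]) n = 0. Proof. by []. Qed.

Let R4_act_linear b x : linear (R4_act b x).
Proof.
case: x => a u v; apply/funext => n; rewrite fctD fctZ; case: b;
  rewrite /R4_act ?fctD ?fctZ ?(mulrDr, mulr0, addr0) // mulrCA //.
Qed.

Lemma R4_nontrivial : ~ star_congr R4_rel 1%T (Scal 0).
Proof.
have qS n : q ^ (n + 1) = q ^ n * q by rewrite expfzDr.
have qP n : q ^ (n - 1) = q ^ n / q by rewrite expfzDr.
have qN n : q ^ (- n) = (q ^ n)^-1 by rewrite -invr_expz.
have qn0 n : q ^ n != 0 by rewrite expfz_neq0.
have PS (n : int) : n + 1 - 1 = n by rewrite addrK.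
have SP (n : int) : n - 1 + 1 = n by rewrite subrK.
have qr2 : (q ^+ 2)^* = q ^+ 2 by rewrite rmorphXn /= q_real.
have qrV : (q^-1)^* = q^-1 by rewrite conjc_inv q_real.
have qrN : (- q^-1)^* = - q^-1 by rewrite rmorphN /= qrV.
have N1r : ((-1 : R[i])^*) = -1 by rewrite rmorphN rmorph1.
pose one : int -> R[i] := fun=> 1.
apply: (termact_nontrivial R4_act_linear (v := one)); last first.
  apply/eqP => /(congr1 (@^~ 0)) /= /eqP; by rewrite oner_eq0.
move=> s t; case=> {s t} b v; apply/funext => n; case: b.
all: cbv beta iota zeta delta [termact R4_act comp negb].
all: rewrite ?fctD ?fctZ ?q_real ?qr2 ?qrV ?qrN ?N1r ?fct0 ?(PS, SP, qN, qS, qP).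
all: rewrite ?(mulr0, addr0).
all: try by [].
all: by have := qn0 n; move: (q ^ n) => p p0; field; rewrite ?q_neq0 ?p0.
Qed.

End R4.

Variable q : {posnum R}.

Lemma posnumC_neq0 : (q%:num)%:C != 0.
Proof. by rewrite eq_complex /= negb_and gt_eqF. Qed.

(* The algebra $\widetilde{{}_{SN}\mathbb{R}^4_q}$. *)
Definition R4_presentation :=
  Presentation (R4_nontrivial posnumC_neq0 (conjc_real q%:num)).
Definition SNR4 := presented R4_presentation.


Inductive SU2_gen := X23 | X24.

Section SU2.
Local Notation x23 := (Gen X23).
Local Notation x24 := (Gen X24).
Local Open Scope star_term_scope.

Inductive SU2_rel : starTerm R SU2_gen -> starTerm R SU2_gen -> Prop :=
| SU2_comm s t : SU2_rel (s * t) (t * s)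
| SU2_sphere : SU2_rel (x23^* * x23 + x24^* * x24) 1.

End SU2.

Section SU2_action.
Variables (V : lmodType R[i]) (g : bool -> SU2_gen -> V -> V).
Hypothesis g_linear : forall b x, linear (g b x).
Hypothesis g_comm : forall b b' x y v, g b x (g b' y v) = g b' y (g b x v).
Hypothesis g_sphere : forall v,
  g true X23 (g false X23 v) + g true X24 (g false X24 v) = v.

Lemma SU2_act_rel s t : SU2_rel s t ->
  forall b v, termact g b s v = termact g b t v.
Proof.
case=> {s t} [s t|] [] v; rewrite /= ?(termact_comm g_linear g_comm s t) //.
- by rewrite conjc1 scale1r g_sphere.
- by rewrite scale1r g_sphere.
Qed.

Lemma SU2_act_congr s t : star_congr SU2_rel s t ->
  forall b v, termact g b s v = termact g b t v.
Proof. exact: (termact_congr g_linear SU2_act_rel). Qed.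
End SU2_action.

(* The point x23 = 0, x24 = 1 of SU(2). *)
Let SU2_pt (b : bool) (x : SU2_gen) (v : R[i]) : R[i] :=
  if x is X24 then v else 0.

Let SU2_pt_linear b x : linear (SU2_pt b x).
Proof. by case: x => a u v //=; rewrite scaler0 addr0. Qed.

Let SU2_pt_comm b b' x y v :
  SU2_pt b x (SU2_pt b' y v) = SU2_pt b' y (SU2_pt b x v).
Proof. by case: x y => -[]. Qed.

Let SU2_pt_sphere v :
  SU2_pt true X23 (SU2_pt false X23 v) +
  SU2_pt true X24 (SU2_pt false X24 v) = v.
Proof. by rewrite /= add0r. Qed.

Lemma SU2_nontrivial : ~ star_congr SU2_rel 1%T (Scal 0).
Proof.
apply: (termact_nontrivial SU2_pt_linear (v := 1)); last exact: oner_neq0.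
exact: (SU2_act_rel SU2_pt_linear SU2_pt_comm SU2_pt_sphere).
Qed.

Definition SU2_presentation := Presentation SU2_nontrivial.
Definition ASU2 := presented SU2_presentation.

Inductive Laurent_gen := Rp | Rm.

Section Laurent.
Local Notation r := (Gen Rp).
Local Notation rinv := (Gen Rm).
Local Open Scope star_term_scope.

Inductive Laurent_rel : starTerm R Laurent_gen -> starTerm R Laurent_gen -> Prop :=
| Laurent_comm s t : Laurent_rel (s * t) (t * s)
| Laurent_mulV : Laurent_rel (r * rinv) 1
| Laurent_mulVl : Laurent_rel (rinv * r) 1
| Laurent_star : Laurent_rel (r^*) r.

End Laurent.

Section Laurent_action.
Variables (V : lmodType R[i]) (T : Laurent_gen -> V -> V).
Hypothesis T_linear : forall x, linear (T x).
Hypothesis TK : cancel (T Rp) (T Rm).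
Hypothesis TVK : cancel (T Rm) (T Rp).
Let g (b : bool) := T.

Lemma Laurent_act_rel s t : Laurent_rel s t ->
  forall b v, termact g b s v = termact g b t v.
Proof.
have gl b x : linear (g b x) by exact: T_linear.
have gC b b' x y v : g b x (g b' y v) = g b' y (g b x v).
  by case: x y => -[] //; rewrite /g TK TVK.
case=> {s t} [s t|||] [] v; rewrite /= ?(termact_comm gl gC s t) //;
  by rewrite ?conjc1 scale1r ?TK ?TVK.
Qed.

Lemma Laurent_act_congr s t : star_congr Laurent_rel s t ->
  forall b v, termact g b s v = termact g b t v.
Proof. exact: (termact_congr (fun=> T_linear) Laurent_act_rel). Qed.
End Laurent_action.

Lemma Laurent_nontrivial : ~ star_congr Laurent_rel 1%T (Scal 0).
Proof.
apply: (@termact_nontrivial R _ R[i] (fun _ _ => id) _ _ 1); last exact: oner_neq0.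
  by [].
exact: (@Laurent_act_rel R[i] (fun=> id)).
Qed.

Definition Laurent_presentation := Presentation Laurent_nontrivial.
Definition Laurent := presented Laurent_presentation.

End Algebras.

Section Span.
Variables (K : comNzRingType) (V : lmodType K) (S : V -> Prop).

Inductive lspan : V -> Prop :=
| Lspan0 : lspan 0
| LspanZD c v w : S v -> lspan w -> lspan (c *: v + w).

Lemma lspanD v w : lspan v -> lspan w -> lspan (v + w).
Proof.
elim=> [|c u v' Su _ IH] Sw; first by rewrite add0r.
by rewrite -addrA; apply: LspanZD => //; apply: IH.
Qed.

Lemma lspanZ c v : lspan v -> lspan (c *: v).
Proof.
elim=> [|d u v' Su _ IH]; first by rewrite scaler0; apply: Lspan0.
by rewrite scalerDr scalerA; apply: LspanZD.
Qed.

Lemma lspan_gen v : S v -> lspan v.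
Proof.
by move=> Sv; rewrite -[v]scale1r -[_ *: v]addr0; apply: LspanZD => //; apply: Lspan0.
Qed.
End Span.

Lemma lspanM (K : comNzRingType) (A : algType K) (S : A -> Prop) :
  (forall x y, S x -> S y -> S (x * y)) ->
  forall x y, lspan S x -> lspan S y -> lspan S (x * y).
Proof.
move=> SM x y Sx; elim=> [|c u v Su _ IH].
  by rewrite mulr0; apply: Lspan0.
rewrite mulrDr; apply: lspanD => {IH}//; rewrite -scalerAr; apply: lspanZ.
elim: Sx => [|d w z Sw _ IH]; first by rewrite mul0r; apply: Lspan0.
by rewrite mulrDl -scalerAl; apply: LspanZD => //; apply: SM.
Qed.

Section StarLemmas.
Variables (R : realType) (A : starAlgType R).

Lemma star0 : star (0 : A) = 0.
Proof. by apply: (@addrI _ (star 0)); rewrite -starD !addr0. Qed.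
Lemma star1 : star (1 : A) = 1.
Proof. by rewrite -[LHS]mulr1 -{2}[1]starK -starM mulr1 starK. Qed.
Lemma starX (x : A) n : star (x ^+ n) = star x ^+ n.
Proof.
by elim: n => [|n IHn]; rewrite ?expr0 ?star1 // exprS starM IHn exprSr.
Qed.

Lemma lspan_star (S : A -> Prop) : (forall x, S x -> S (star x)) ->
  forall x, lspan S x -> lspan S (star x).
Proof.
move=> Ss x; elim=> [|c u v Su _ IH]; first by rewrite star0; apply: Lspan0.
by rewrite starD starZ; apply: LspanZD => //; apply: Ss.
Qed.
End StarLemmas.

Lemma linear_lspan (K : comNzRingType) (V W : lmodType K) (S : V -> Prop)
    (f g : V -> W) : linear f -> linear g -> (forall v, S v -> f v = g v) ->
  forall v, lspan S v -> f v = g v.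
Proof.
move=> lf lg fg v; elim=> [|c u w Su _ IH]; last by rewrite lf lg fg // IH.
have h0 (h : V -> W) : linear h -> h 0 = 0.
  by move=> lh; have := lh (-1) 0 0; rewrite scaler0 addr0 scaleN1r addNr.
by rewrite !h0.
Qed.

Section Gens.
Variable R : realType.

HB.instance Definition _ q := StarAlgebra.on (SNR4 (R := R) q).
HB.instance Definition _ := StarAlgebra.on (ASU2 R).
HB.instance Definition _ := StarAlgebra.on (Laurent R).

Fact ASU2_mulC : commutative (@GRing.mul (ASU2 R)).
Proof.
move=> x y; have [s ->] := pres_surj x; have [t ->] := pres_surj y.
by rewrite -!pcls_Mul; apply/pclsP/Congr_rel/SU2_comm.
Qed.
HB.instance Definition _ :=
  GRing.PzRing_hasCommutativeMul.Build (ASU2 R) ASU2_mulC.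

Fact Laurent_mulC : commutative (@GRing.mul (Laurent R)).
Proof.
move=> x y; have [s ->] := pres_surj x; have [t ->] := pres_surj y.
by rewrite -!pcls_Mul; apply/pclsP/Congr_rel/Laurent_comm.
Qed.
HB.instance Definition _ :=
  GRing.PzRing_hasCommutativeMul.Build (Laurent R) Laurent_mulC.

Definition x23 : ASU2 R := pgen (P := SU2_presentation R) X23.
Definition x24 : ASU2 R := pgen (P := SU2_presentation R) X24.
Definition laurent_r : Laurent R := pgen (P := Laurent_presentation R) Rp.
Definition laurent_rinv : Laurent R := pgen (P := Laurent_presentation R) Rm.

Definition beta (q : {posnum R}) (x : R4_gen) : SNR4 q :=
  pgen (P := R4_presentation q) x.

Definition mon (a b c d : nat) : ASU2 R :=
  x23 ^+ a * star x23 ^+ b * x24 ^+ c * star x24 ^+ d.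

Definition is_twist (q : {posnum R})
    (Psi : tensor (Laurent R) (ASU2 R) -> tensor (ASU2 R) (Laurent R)) :=
  let k : R[i] := (q%:num)%:C in
  linear Psi /\
  forall n a b c d : nat,
    Psi (pure (laurent_r ^+ n) (mon a b c d)) =
      k ^ ((n * (a + c))%N%:Z - (n * (b + d))%N%:Z)
        *: pure (mon a b c d) (laurent_r ^+ n) /\
    Psi (pure (laurent_rinv ^+ n) (mon a b c d)) =
      k ^ ((n * (b + d))%N%:Z - (n * (a + c))%N%:Z)
        *: pure (mon a b c d) (laurent_rinv ^+ n).

Lemma r_rinv : laurent_r * laurent_rinv = 1.
Proof.
by rewrite /laurent_r /laurent_rinv -!pcls_Gen -pcls_Mul -[RHS]scale1r -pcls_Scal;
  apply/pclsP/Congr_rel/Laurent_mulV.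
Qed.
Lemma star_r : star laurent_r = laurent_r.
Proof. by rewrite /laurent_r -pcls_Gen -pcls_Star; apply/pclsP/Congr_rel/Laurent_star. Qed.
Lemma star_rinv : star laurent_rinv = laurent_rinv.
Proof.
rewrite -[LHS]mulr1 -r_rinv mulrA -{1}star_r -starM r_rinv star1 mul1r //.
Qed.

Lemma monM a b c d a' b' c' d' :
  mon a b c d * mon a' b' c' d' = mon (a + a') (b + b') (c + c') (d + d').
Proof.
rewrite /mon !exprD mulrACA; congr (_ * _); rewrite mulrACA; congr (_ * _).
exact: mulrACA.
Qed.
Lemma star_mon a b c d : star (mon a b c d) = mon b a d c.
Proof.
rewrite /mon !starM !starX !starK.
by rewrite mulrA mulrC mulrA.
Qed.

Definition is_mon (x : ASU2 R) := exists a b c d, x = mon a b c d.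

Lemma ASU2_span x : lspan is_mon x.
Proof.
have mP a b c d : lspan is_mon (mon a b c d).
  by apply: lspan_gen; exists a, b, c, d.
have m1 : mon 0 0 0 0 = 1 by rewrite /mon !expr0 !mulr1.
elim/presented_ind: x => [[]|c|x y|x y|x].
- by rewrite -[pgen _]/x23; have := mP 1 0 0 0; rewrite /mon expr1 !expr0 !mulr1.
- by rewrite -[pgen _]/x24; have := mP 0 0 1 0; rewrite /mon expr1 !expr0 !mulr1 mul1r.
- by rewrite -m1; apply: lspanZ.
- exact: lspanD.
- apply: lspanM => _ _ [a [b [c [d ->]]]] [a' [b' [c' [d' ->]]]].
  by rewrite monM; do 4!eexists.
- apply: lspan_star => _ [a [b [c [d ->]]]].
  by rewrite star_mon; do 4!eexists.
Qed.

Definition rpow (n : int) : Laurent R :=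
  match n with Posz n => laurent_r ^+ n | Negz n => laurent_rinv ^+ n.+1 end.

Lemma rpowS n : rpow (n + 1) = laurent_r * rpow n.
Proof.
case: n => [n|[|n]].
- by rewrite -[1]/(1%:Z) -PoszD addn1 /= exprS.
- by rewrite /= expr1 r_rinv.
- have -> : Negz n.+1 + 1 = Negz n by rewrite !NegzE; lia.
  by rewrite /= [in RHS]exprS mulrA r_rinv mul1r.
Qed.
Lemma rpowP n : rpow (n - 1) = laurent_rinv * rpow n.
Proof. by rewrite -{2}[n](subrK 1) rpowS mulrA [laurent_rinv * _]mulrC r_rinv mul1r. Qed.
Lemma rpowD m n : rpow (m + n) = rpow m * rpow n.
Proof.
elim: m => [|m IHm|m IHm]; first by rewrite add0r mul1r.
- by rewrite -addn1 PoszD addrAC !rpowS IHm mulrA.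
- by rewrite -addn1 PoszD opprD addrAC !rpowP IHm mulrA.
Qed.
Lemma star_rpow n : star (rpow n) = rpow n.
Proof. by case: n => n /=; rewrite starX ?star_r ?star_rinv. Qed.

Definition is_rpow (j : Laurent R) := exists n, j = rpow n.
Lemma Laurent_span j : lspan is_rpow j.
Proof.
have rP n : lspan is_rpow (rpow n) by apply: lspan_gen; exists n.
elim/presented_ind: j => [[]|c|x y|x y|x].
- exact: (rP 1).
- exact: (rP (-1)).
- by apply: lspanZ; apply: (rP 0).
- exact: lspanD.
- apply: lspanM => _ _ [n ->] [m ->]; rewrite -rpowD; by exists (n + m).
- by apply: lspan_star => _ [n ->]; rewrite star_rpow; exists n.
Qed.

End Gens.

Section LinearFacts.
Variables (K : comNzRingType) (V W : lmodType K) (f : V -> W).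
Hypothesis f_lin : linear f.
Lemma linfD u v : f (u + v) = f u + f v.
Proof. by rewrite -[u in LHS]scale1r f_lin scale1r. Qed.
Lemma linf0 : f 0 = 0.
Proof. by apply: (@addrI _ (f 0)); rewrite -linfD !addr0. Qed.
Lemma linfZ c u : f (c *: u) = c *: f u.
Proof. by rewrite -[c *: u]addr0 f_lin linf0 addr0. Qed.
End LinearFacts.

Lemma comp_linear (K : comNzRingType) (U V W : lmodType K)
  (f : V -> W) (g : U -> V) : linear f -> linear g -> linear (f \o g).
Proof. by move=> lf lg c u v; rewrite /= lg lf. Qed.

Section BilinLift.
Variables (K : comNzRingType) (U V W : lmodType K) (b : U -> V -> W).
Hypothesis bl : forall v, linear (b^~ v).
Hypothesis br : forall u, linear (b u).

Let bDl u u' v : b (u + u') v = b u v + b u' v.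
Proof. exact: (linfD (bl v)). Qed.
Let bDr u v v' : b u (v + v') = b u v + b u v'.
Proof. exact: (linfD (br u)). Qed.
Let bZ c u v : b (c *: u) v = b u (c *: v).
Proof. by rewrite (linfZ (br u)) (linfZ (bl v)). Qed.

Lemma tlift_pureE u v : tlift b (pure u v) = b u v.
Proof. exact: tlift_pure. Qed.

Lemma tlift_linear : linear (tlift b).
Proof.
move=> c x y; rewrite (tliftD bDl bDr bZ).
rewrite (@tliftZ _ _ _ _ b idfun bDl bDr) // => d u v /=.
- exact: (linfZ (bl v)).
- exact: (linfZ (br u)).
Qed.
End BilinLift.

Section PureLinear.
Variables (K : comNzRingType) (U V : lmodType K).
Lemma pure_linl (v : V) : linear (fun u : U => pure u v).
Proof. by move=> c x y; rewrite pureDl pureZl. Qed.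
Lemma pure_linr (u : U) : linear (pure u : V -> _).
Proof. by move=> c x y; rewrite pureDr pureZr. Qed.

Lemma tensor_span (SU : U -> Prop) (SV : V -> Prop) :
  (forall u, lspan SU u) -> (forall v, lspan SV v) ->
  forall x : tensor U V,
  lspan (fun y => exists u v, [/\ SU u, SV v & y = pure u v]) x.
Proof.
move=> Us Vs; elim/tensor_ind => [|u v x Sx]; first exact: Lspan0.
apply: lspanD => {x Sx}//.
elim: (Us u) => [|c u' w Su' _ IH].
  by rewrite (linf0 (pure_linl v)); apply: Lspan0.
rewrite pure_linl; apply: lspanD => {w IH}//; apply: lspanZ.
elim: (Vs v) => [|d v' w Sv' _ IH].
  by rewrite (linf0 (pure_linr u')); apply: Lspan0.
by rewrite pure_linr; apply: LspanZD => //; exists u', v'.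
Qed.

Lemma tensor_eq (W : lmodType K) (f g : tensor U V -> W) :
  linear f -> linear g -> (forall u v, f (pure u v) = g (pure u v)) -> f =1 g.
Proof.
move=> lf lg fg; elim/tensor_ind => [|u v x IH]; first by rewrite !linf0.
by rewrite (linfD lf) (linfD lg) fg IH.
Qed.
End PureLinear.

(* The automorphism of A(SU(2)) with x23, x24 |-> l x23, l x24 and
   x23^*, x24^* |-> l^-1 x23^*, l^-1 x24^*. *)
Section Tau.
Variable R : realType.
Local Notation A := (ASU2 R).

Let gA (x : SU2_gen) : A := pgen (P := SU2_presentation R) x.
Let tau_g (l : R[i]) (b : bool) (x : SU2_gen) (v : A) : A :=
  if b then l^-1 *: (star (gA x) * v) else l *: (gA x * v).

Let tau_term l b t : A -> A := termact (tau_g l) b t.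

Definition tau (l : R[i]) (x : A) : A := tau_term l false (repr x) 1.

Lemma sphere : star (x23 R) * x23 R + star (x24 R) * x24 R = 1.
Proof.
rewrite /x23 /x24 -!pcls_Gen -!pcls_Star -!pcls_Mul -pcls_Add.
by rewrite -[RHS]scale1r -pcls_Scal; apply/pclsP/Congr_rel/SU2_sphere.
Qed.

Variable l : R[i].
Hypothesis l0 : l != 0.

Let tau_g_linear b x : linear (tau_g l b x).
Proof.
move=> c u v; rewrite /tau_g; case: b;
  by rewrite mulrDr scalerDr -scalerAr !scalerA [c * _]mulrC.
Qed.

Let tau_g_comm b b' x y v : tau_g l b x (tau_g l b' y v) = tau_g l b' y (tau_g l b x v).
Proof.
rewrite /tau_g; case: b; case: b';
by rewrite -!scalerAr !scalerA mulrC; congr (_ *: _); rewrite mulrCA.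
Qed.

Let tau_g_sphere v : tau_g l true X23 (tau_g l false X23 v) +
  tau_g l true X24 (tau_g l false X24 v) = v.
Proof.
rewrite /tau_g -!scalerAr !scalerA mulVf // !scale1r !mulrA -mulrDl.
by rewrite sphere mul1r.
Qed.

Let tau_term_congr := SU2_act_congr tau_g_linear tau_g_comm tau_g_sphere.

Let tau_pcls t : tau l (pcls t) = tau_term l false t 1.
Proof. exact: tau_term_congr (repr_pcls t) _ _. Qed.

Let tau_term_mul t : forall b v w, tau_term l b t (v * w) = tau_term l b t v * w.
Proof.
rewrite /tau_term; elim: t => [x|c|s Hs t Ht|s Hs t Ht|s Hs] b v w //=.
- by rewrite /tau_g; case: b; rewrite mulrA scalerAl.
- by rewrite scalerAl.
- by rewrite Hs Ht mulrDl.
- by case: b; rewrite /= ?(Hs, Ht).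
Qed.

Lemma tauM x y : tau l (x * y) = tau l x * tau l y.
Proof.
have [s ->] := pres_surj x; have [t ->] := pres_surj y.
rewrite -pcls_Mul !tau_pcls /tau_term /=.
by rewrite -[X in _ s X]mul1r [LHS]tau_term_mul.
Qed.

Lemma tauZ c x : tau l (c *: x) = c *: tau l x.
Proof.
have tS : tau l c%:A = c%:A by rewrite -pcls_Scal tau_pcls /= pcls_Scal.
by rewrite -[c *: x]mulr_algl tauM tS mulr_algl.
Qed.

Lemma tau_linear : linear (tau l).
Proof.
move=> c x y; rewrite -tauZ; move: (c *: x) => {}x.
have [s ->] := pres_surj x; have [t ->] := pres_surj y.
by rewrite -pcls_Add !tau_pcls.
Qed.

Lemma tau1 : tau l 1 = 1.
Proof. by rewrite -[1]scale1r -pcls_Scal tau_pcls /= scale1r. Qed.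

Lemma tauX x n : tau l (x ^+ n) = tau l x ^+ n.
Proof. by elim: n => [|n IHn]; rewrite ?expr0 ?tau1 // !exprS tauM IHn. Qed.

Lemma tau_mon a b c d :
  tau l (mon R a b c d) = l ^ ((a + c)%N%:Z - (b + d)%N%:Z) *: mon R a b c d.
Proof.
have g x : tau l (gA x) = l *: gA x.
  by rewrite /gA -pcls_Gen tau_pcls /= /tau_g mulr1.
have gs x : tau l (star (gA x)) = l^-1 *: star (gA x).
  by rewrite {1}/gA -pcls_Gen -pcls_Star tau_pcls /= /tau_g mulr1 pcls_Star.
rewrite /mon !tauM !tauX.
rewrite -[x23 R]/(gA X23) -[x24 R]/(gA X24) !g !gs !exprZn.
have E (u v : R[i]) (x y : A) : (u *: x) * (v *: y) = (u * v) *: (x * y).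
  by rewrite -scalerAl -scalerAr scalerA.
rewrite !E; congr (_ *: _).
rewrite expfzDr // -invr_expz -!exprnP !exprVn !exprD invfM.
by rewrite -!mulrA; congr (_ * _); rewrite mulrCA.
Qed.

End Tau.

Section Twist.
Variables (R : realType) (q : {posnum R}).
Local Notation A := (ASU2 R).
Local Notation L := (Laurent R).
Local Notation k := ((q%:num)%:C).
Local Notation k0 := (posnumC_neq0 q).
Let kV0 : k^-1 != 0. Proof. by rewrite invr_eq0 k0. Qed.

Let T (x : Laurent_gen) : tensor A L -> tensor A L :=
  match x with
  | Rp => tlift (fun a j => pure (tau k a) (laurent_r R * j))
  | Rm => tlift (fun a j => pure (tau k^-1 a) (laurent_rinv R * j))
  end.

Let Tl (l : R[i]) (l0 : l != 0) y j :
  linear (fun a => pure (tau l a) (y * j : L)).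
Proof. by move=> c a b; rewrite tau_linear // pureDl pureZl. Qed.

Let Tr (l : R[i]) y (a : A) :
  linear (fun j : L => pure (tau l a) (y * j)).
Proof. by move=> c i j; rewrite mulrDr -scalerAr pureDr pureZr. Qed.

Let Tp_pure a j : T Rp (pure a j) = pure (tau k a) (laurent_r R * j).
Proof. exact: (tlift_pureE (Tl k0 (laurent_r R)) (Tr k (laurent_r R))). Qed.
Let Tm_pure a j : T Rm (pure a j) = pure (tau k^-1 a) (laurent_rinv R * j).
Proof. exact: (tlift_pureE (Tl kV0 (laurent_rinv R)) (Tr k^-1 (laurent_rinv R))). Qed.

Let T_linear x : linear (T x).
Proof.
case: x; apply: tlift_linear => ?.
- exact: Tl k0 _ _.
- exact: Tr.
- exact: Tl kV0 _ _.
- exact: Tr.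
Qed.

Let tauK (l m : R[i]) : l != 0 -> m != 0 -> l * m = 1 ->
  forall x : A, tau l (tau m x) = x.
Proof.
move=> l0 m0 lm x; apply: (linear_lspan (f := tau l \o tau m) (g := id) _ _ _
  (ASU2_span x)) => // [c u v|_ [a [b [c [d ->]]]]] /=.
  by rewrite !tau_linear.
by rewrite tau_mon // tauZ // tau_mon // scalerA -exprzMl ?unitfE // mulrC lm exp1rz scale1r.
Qed.

Let TK : cancel (T Rp) (T Rm).
Proof.
apply: (@tensor_eq _ _ _ _ (T Rm \o T Rp) id) => [|//|a j].
  by apply: comp_linear; apply: T_linear.
rewrite -[LHS]/(T Rm (T Rp _)) /idfun Tp_pure Tm_pure tauK ?mulVf ?k0 //.
by rewrite mulrA [laurent_rinv R * _]mulrC r_rinv mul1r.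
Qed.

Let TVK : cancel (T Rm) (T Rp).
Proof.
apply: (@tensor_eq _ _ _ _ (T Rp \o T Rm) id) => [|//|a j].
  by apply: comp_linear; apply: T_linear.
rewrite -[LHS]/(T Rp (T Rm _)) /idfun Tm_pure Tp_pure tauK ?mulfV ?k0 //.
by rewrite mulrA r_rinv mul1r.
Qed.

Let rho (j : L) : tensor A L -> tensor A L := termact (fun=> T) false (repr j).

Let rho_pcls t v : rho (pcls t) v = termact (fun=> T) false t v.
Proof. exact: (Laurent_act_congr T_linear TK TVK (repr_pcls t)). Qed.

Let rhoM i j v : rho (i * j) v = rho i (rho j v).
Proof.
have [s ->] := pres_surj i; have [t ->] := pres_surj j.
by rewrite -pcls_Mul !rho_pcls.
Qed.

Let rho_scal c v : rho c%:A v = c *: v.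
Proof. by rewrite -pcls_Scal rho_pcls. Qed.

Let rho_linl v : linear (rho^~ v).
Proof.
move=> c i j; rewrite -[c *: i]mulr_algl.
have -> : rho (c%:A * i + j) v = rho (c%:A * i) v + rho j v.
  move: (c%:A * i) => {}i.
  have [s ->] := pres_surj i; have [t ->] := pres_surj j.
  by rewrite -pcls_Add !rho_pcls.
by rewrite rhoM rho_scal.
Qed.

Let rho_linr j : linear (rho j).
Proof.
by have [s ->] := pres_surj j => c u v; rewrite !rho_pcls;
  apply: termact_linear => b x; apply: T_linear.
Qed.

Let Psi0 := tlift (fun j x => rho j (pure x 1)).

Let Psi0_br j : linear (fun x => rho j (pure x 1)).
Proof. by move=> c x y; rewrite pure_linl rho_linr. Qed.

Let Psi0_pure j x : Psi0 (pure j x) = rho j (pure x 1).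
Proof. exact: (tlift_pureE (fun x => rho_linl (pure x 1)) Psi0_br). Qed.

Lemma twist_exists : exists Psi, is_twist q Psi.
Proof.
exists Psi0; split.
  exact: (tlift_linear (fun x => rho_linl (pure x 1)) Psi0_br).
have rho1 v : rho 1 v = v by rewrite -[1]scale1r rho_scal scale1r.
have rho_r v : rho (laurent_r R) v = T Rp v by rewrite /laurent_r -pcls_Gen rho_pcls.
have rho_rinv v : rho (laurent_rinv R) v = T Rm v by rewrite /laurent_rinv -pcls_Gen rho_pcls.
move=> n a b c d; rewrite !Psi0_pure; set m := mon R a b c d.
set e := (a + c)%N%:Z - (b + d)%N%:Z.
split.
- have -> : (n * (a + c))%N%:Z - (n * (b + d))%N%:Z = e * n%:Z.
    by rewrite !PoszM -mulrBr mulrC.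
  rewrite -exprz_exp -exprnP; elim: n => [|n IHn].
    by rewrite !expr0 rho1 scale1r.
  rewrite exprS rhoM IHn (linfZ (rho_linr _)) rho_r Tp_pure tau_mon ?k0 //.
  by rewrite pureZl scalerA -exprSr.
- have -> : (n * (b + d))%N%:Z - (n * (a + c))%N%:Z = - e * n%:Z.
    by rewrite !PoszM -mulrBr mulrC /e opprB.
  rewrite -exprz_exp -exprnP; elim: n => [|n IHn].
    by rewrite !expr0 rho1 scale1r.
  rewrite exprS rhoM IHn (linfZ (rho_linr _)) rho_rinv Tm_pure tau_mon //.
  by rewrite pureZl scalerA [in RHS]exprSr exprz_inv.
Qed.

(* Psi is determined by its values in [is_twist]. *)
Lemma twist_unique Psi Psi' : is_twist q Psi -> is_twist q Psi' -> Psi =1 Psi'.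
Proof.
move=> [l H] [l' H'] x.
apply: (linear_lspan l l' _
  (tensor_span (@Laurent_span R) (@ASU2_span R) x)).
move=> _ [j [y [[n ->] [a [b [c [d ->]]]] ->]]].
case: n => n /=.
- by rewrite (H n a b c d).1 (H' n a b c d).1.
- by rewrite (H n.+1 a b c d).2 (H' n.+1 a b c d).2.
Qed.

Definition Psi : tensor L A -> tensor A L := sval (cid twist_exists).

Lemma PsiP : is_twist q Psi. Proof. exact: svalP (cid twist_exists). Qed.

Lemma Psi_linear : linear Psi. Proof. by case: PsiP. Qed.

Lemma Psi_rpow n a b c d : Psi (pure (rpow R n) (mon R a b c d)) =
  k ^ (n * ((a + c)%N%:Z - (b + d)%N%:Z)) *: pure (mon R a b c d) (rpow R n).
Proof.
have [_ H] := PsiP; case: n => n /=.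
- by rewrite (H n a b c d).1 !PoszM mulrBr.
- by rewrite (H n.+1 a b c d).2 !PoszM -mulrBr NegzE mulNr -mulrN opprB.
Qed.

End Twist.

Section TwistedProduct.
Variables (R : realType) (q : {posnum R}).
Local Notation A := (ASU2 R).
Local Notation L := (Laurent R).
Local Notation k := ((q%:num)%:C).
Local Notation k0 := (posnumC_neq0 q).
Local Notation mon := (mon R).
Local Notation rpow := (rpow R).

(* q only selects the multiplication and the involution. *)
Definition twistedProduct of {posnum R} : Type := tensor A L.
Local Notation twisted := (twistedProduct q).

HB.instance Definition _ := GRing.Lmodule.on twisted.

Definition mul_pure (x : A) (j : L) : twisted -> twisted :=
  tlift (fun a i => pure (x * a) (i * j)).

(* (x ⊗ i) (y ⊗ j) = (m ⊗ m) (x ⊗ Psi (i ⊗ y) ⊗ j) *)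
Definition tw_mul (s t : twisted) : twisted :=
  tlift (fun x i => tlift (fun y j => mul_pure x j (Psi q (pure i y))) t) s.

(* (x ⊗ j)^* = Psi (j^* ⊗ x^* ) *)
Definition tw_star (s : twisted) : twisted :=
  tlift (fun x j => Psi q (pure (star j) (star x))) s.

Definition tw_one : twisted := pure 1 1.

Let mul_pure_E x j a i : mul_pure x j (pure a i) = pure (x * a) (i * j).
Proof.
apply: tlift_pureE => [v c u w|u c v w].
- by rewrite mulrDr -scalerAr pure_linl.
- by rewrite mulrDl -scalerAl pure_linr.
Qed.

Let mul_pure_linear x j : linear (mul_pure x j).
Proof.
apply: tlift_linear => [v c u w|u c v w].
- by rewrite mulrDr -scalerAr pure_linl.
- by rewrite mulrDl -scalerAl pure_linr.
Qed.

Let mul_pure_linl j t : linear (fun x => mul_pure x j t).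
Proof.
move=> c x y; elim/tensor_ind: t => [|a i t IH].
  by rewrite !(linf0 (mul_pure_linear _ _)) scaler0 addr0.
rewrite !(linfD (mul_pure_linear _ _)) IH !mul_pure_E.
by rewrite mulrDl -scalerAl pure_linl scalerDr addrACA.
Qed.

Let mul_pure_linr x t : linear (fun j => mul_pure x j t).
Proof.
move=> c i j; elim/tensor_ind: t => [|a l t IH].
  by rewrite !(linf0 (mul_pure_linear _ _)) scaler0 addr0.
rewrite !(linfD (mul_pure_linear _ _)) IH !mul_pure_E.
by rewrite mulrDr -scalerAr pure_linr scalerDr addrACA.
Qed.

Let PsiL := Psi_linear q.

Let inner x i := fun (y : A) (j : L) => mul_pure x j (Psi q (pure i y)).

Let inner_l x i j : linear ((inner x i)^~ j).
Proof. by move=> c y z; rewrite /inner pure_linr PsiL mul_pure_linear. Qed.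

Let inner_r x i y : linear (inner x i y).
Proof. by move=> c j l; rewrite /inner mul_pure_linr. Qed.

Let tw_mul_pure1 x i t : tw_mul (pure x i) t = tlift (inner x i) t.
Proof.
apply: (tlift_pureE (b := fun x i => tlift (inner x i) t)).
- move=> {}i c {}x y; elim/tensor_ind: t => [|a l t IH].
    by rewrite !(linf0 (tlift_linear (inner_l _ _) (inner_r _ _))) scaler0 addr0.
  rewrite !(linfD (tlift_linear (inner_l _ _) (inner_r _ _))) IH.
  rewrite !(tlift_pureE (inner_l _ _) (inner_r _ _)).
  by rewrite {1}/inner mul_pure_linl scalerDr addrACA.
- move=> {}x c {}i j; elim/tensor_ind: t => [|a l t IH].
    by rewrite !(linf0 (tlift_linear (inner_l _ _) (inner_r _ _))) scaler0 addr0.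
  rewrite !(linfD (tlift_linear (inner_l _ _) (inner_r _ _))) IH.
  rewrite !(tlift_pureE (inner_l _ _) (inner_r _ _)).
  by rewrite {1}/inner pure_linl PsiL mul_pure_linear scalerDr addrACA.
Qed.

Lemma tw_mulE x i y j :
  tw_mul (pure x i) (pure y j) = mul_pure x j (Psi q (pure i y)).
Proof. by rewrite tw_mul_pure1 (tlift_pureE (inner_l _ _) (inner_r _ _)). Qed.

Lemma tw_mul_linl t : linear (tw_mul^~ t).
Proof.
apply: tlift_linear => [i c x y|x c i j].
- elim/tensor_ind: t => [|a l t IH].
    by rewrite !(linf0 (tlift_linear (inner_l _ _) (inner_r _ _))) scaler0 addr0.
  rewrite !(linfD (tlift_linear (inner_l _ _) (inner_r _ _))) IH.
  rewrite !(tlift_pureE (inner_l _ _) (inner_r _ _)).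
  by rewrite {1}/inner mul_pure_linl scalerDr addrACA.
- elim/tensor_ind: t => [|a l t IH].
    by rewrite !(linf0 (tlift_linear (inner_l _ _) (inner_r _ _))) scaler0 addr0.
  rewrite !(linfD (tlift_linear (inner_l _ _) (inner_r _ _))) IH.
  rewrite !(tlift_pureE (inner_l _ _) (inner_r _ _)).
  by rewrite {1}/inner pure_linl PsiL mul_pure_linear scalerDr addrACA.
Qed.

Lemma tw_mul_linr s : linear (tw_mul s).
Proof.
move=> c t u; elim/tensor_ind: s => [|x i s IH].
  by rewrite !(linf0 (tw_mul_linl _)) scaler0 addr0.
rewrite !(linfD (tw_mul_linl _)) IH !tw_mul_pure1.
by rewrite (tlift_linear (inner_l _ _) (inner_r _ _)) scalerDr addrACA.
Qed.

Let star_bl (j : L) x y :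
  Psi q (pure (star j) (star (x + y))) =
  Psi q (pure (star j) (star x)) + Psi q (pure (star j) (star y)).
Proof. by rewrite starD pureDr (linfD PsiL). Qed.
Let star_br (x : A) (i j : L) :
  Psi q (pure (star (i + j)) (star x)) =
  Psi q (pure (star i) (star x)) + Psi q (pure (star j) (star x)).
Proof. by rewrite starD pureDl (linfD PsiL). Qed.
Let star_Zl c (x : A) (j : L) :
  Psi q (pure (star j) (star (c *: x))) =
  c^* *: Psi q (pure (star j) (star x)).
Proof. by rewrite starZ pureZr (linfZ PsiL). Qed.
Let star_Zr c (x : A) (j : L) :
  Psi q (pure (star (c *: j)) (star x)) =
  c^* *: Psi q (pure (star j) (star x)).
Proof. by rewrite starZ pureZl (linfZ PsiL). Qed.
Let star_Z c (x : A) (j : L) : Psi q (pure (star j) (star (c *: x))) =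
  Psi q (pure (star (c *: j)) (star x)).
Proof. by rewrite star_Zl star_Zr. Qed.

Lemma tw_starE x j : tw_star (pure x j) = Psi q (pure (star j) (star x)).
Proof.
exact: (tlift_pure (b := fun x j => Psi q (pure (star j) (star x)))
  (fun x y j => star_bl j x y) star_br star_Z).
Qed.

Lemma tw_starD s t : tw_star (s + t) = tw_star s + tw_star t.
Proof. exact: (tliftD (fun x y j => star_bl j x y) star_br star_Z). Qed.

Lemma tw_starZ c s : tw_star (c *: s) = c^* *: tw_star s.
Proof.
exact: (tliftZ (s := @conjc R) (fun x y j => star_bl j x y) star_br
  star_Zl star_Zr).
Qed.

Definition tw_mon (a b c d : nat) (n : int) : twisted :=
  pure (mon a b c d) (rpow n).

Definition is_tw_mon (s : twisted) := exists a b c d n, s = tw_mon a b c d n.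

Lemma twisted_span s : lspan is_tw_mon s.
Proof.
elim: (tensor_span (@ASU2_span R) (@Laurent_span R) s) => [|c u v Su _ IH].
  exact: Lspan0.
apply: LspanZD IH; case: Su => x [j [[a [b [e [d ->]]]] [n ->] ->]].
by exists a, b, e, d, n.
Qed.

Let deg (a b c d : nat) : int := (a + c)%N%:Z - (b + d)%N%:Z.

Let tw_mul_mon a b c d n a' b' c' d' n' :
  tw_mul (tw_mon a b c d n) (tw_mon a' b' c' d' n') =
  k ^ (n * deg a' b' c' d') *:
    tw_mon (a + a') (b + b') (c + c') (d + d') (n + n').
Proof.
rewrite tw_mulE Psi_rpow (linfZ (mul_pure_linear _ _)) mul_pure_E.
by rewrite monM -rpowD.
Qed.

Let tw_star_mon a b c d n : tw_star (tw_mon a b c d n) =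
  k ^ (n * deg b a d c) *: tw_mon b a d c n.
Proof. by rewrite tw_starE star_rpow star_mon Psi_rpow. Qed.

Let degD a b c d a' b' c' d' :
  deg (a + a') (b + b') (c + c') (d + d') = deg a b c d + deg a' b' c' d'.
Proof. by rewrite /deg; lia. Qed.

Let degN a b c d : deg b a d c = - deg a b c d.
Proof. by rewrite /deg; lia. Qed.

Let tw_mul0l t : tw_mul 0 t = 0. Proof. exact: linf0 (tw_mul_linl t). Qed.
Let tw_mul0r s : tw_mul s 0 = 0. Proof. exact: linf0 (tw_mul_linr s). Qed.
Let tw_mulZl c s t : tw_mul (c *: s) t = c *: tw_mul s t.
Proof. exact: (linfZ (tw_mul_linl t)). Qed.
Let tw_mulZr c s t : tw_mul s (c *: t) = c *: tw_mul s t.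
Proof. exact: (linfZ (tw_mul_linr s)). Qed.

Fact tw_mulDl : left_distributive tw_mul +%R.
Proof. by move=> s t u; rewrite (linfD (tw_mul_linl u)). Qed.
Fact tw_mulDr : right_distributive tw_mul +%R.
Proof. by move=> s t u; rewrite (linfD (tw_mul_linr s)). Qed.

Fact tw_mulA : associative tw_mul.
Proof.
move=> s t u; elim: (twisted_span s) => [|z {}s s' Ss _ IH].
  by rewrite !tw_mul0l.
rewrite !tw_mulDl -IH !tw_mulZl; congr (_ *: _ + _) => {z s' IH}.
elim: (twisted_span t) => [|z {}t t' St _ IH]; first by rewrite !(tw_mul0l, tw_mul0r).
rewrite !(tw_mulDl, tw_mulDr) -IH !(tw_mulZl, tw_mulZr).
congr (_ *: _ + _) => {z t' IH}.
elim: (twisted_span u) => [|z {}u u' Su _ IH]; first by rewrite !(tw_mul0l, tw_mul0r).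
rewrite !tw_mulDr -IH !tw_mulZr; congr (_ *: _ + _) => {z u' IH}.
case: Ss St Su => [a [b [c [d [n ->]]]]] [a' [b' [c' [d' [n' ->]]]]].
case=> [e [f [g [h [m ->]]]]].
rewrite !(tw_mul_mon, tw_mulZl, tw_mulZr) !scalerA -!expfzDr ?k0 //.
by rewrite !addnA addrA degD; congr (_ ^ _ *: _); ring.
Qed.

Let tw_oneE : tw_one = tw_mon 0 0 0 0 0.
Proof. by rewrite /tw_one /tw_mon /mon !expr0 !mulr1. Qed.

Fact tw_mul1l : left_id tw_one tw_mul.
Proof.
move=> s; elim: (twisted_span s) => [|z {}s s' Ss _ IH]; first by rewrite tw_mul0r.
rewrite tw_mulDr IH tw_mulZr; congr (_ *: _ + _).
case: Ss => [a [b [c [d [n ->]]]]].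
by rewrite tw_oneE tw_mul_mon mul0r expr0z scale1r add0r !add0n.
Qed.

Fact tw_mul1r : right_id tw_one tw_mul.
Proof.
move=> s; elim: (twisted_span s) => [|z {}s s' Ss _ IH]; first by rewrite tw_mul0l.
rewrite tw_mulDl IH tw_mulZl; congr (_ *: _ + _).
case: Ss => [a [b [c [d [n ->]]]]].
by rewrite tw_oneE tw_mul_mon mulr0 expr0z scale1r addr0 !addn0.
Qed.

Fact tw_one_neq0 : tw_one != 0.
Proof.
pose gA (b : bool) (x : SU2_gen) (v : R[i]) : R[i] := if x is X24 then v else 0.
have gA_linear b x : linear (gA b x).
  by case: x => a u v //=; rewrite scaler0 addr0.
have gA_comm b b' x y v : gA b x (gA b' y v) = gA b' y (gA b x v).
  by case: x y => -[].
have gA_sphere v : gA true X23 (gA false X23 v) + gA true X24 (gA false X24 v) = v.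
  by rewrite /= add0r.
have congrA := SU2_act_congr gA_linear gA_comm gA_sphere.
have congrL := @Laurent_act_congr R R[i] (fun=> id) (fun _ _ _ _ => erefl)
  (fun=> erefl) (fun=> erefl).
pose chiA (x : A) : R[i] := termact gA false (repr x) 1.
pose chiL (v : R[i]) (j : L) : R[i] := termact (fun _ _ => id) false (repr j) v.
have chiA_pcls t : chiA (pcls t) = termact gA false t 1 by exact: congrA (repr_pcls t) _ _.
have chiL_pcls v t : chiL v (pcls t) = termact (fun _ _ => id) false t v.
  exact: congrL (repr_pcls t) _ _.
have chiA_lin : linear chiA.
  move=> c x y; have [s ->] := pres_surj x; have [t ->] := pres_surj y.
  by rewrite -mulr_algl -pcls_Scal -pcls_Mul -pcls_Add !chiA_pcls.
have chiL_linr v : linear (chiL v).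
  move=> c x y; have [s ->] := pres_surj x; have [t ->] := pres_surj y.
  by rewrite -mulr_algl -pcls_Scal -pcls_Mul -pcls_Add !chiL_pcls.
have chiL_linl j : linear (chiL^~ j).
  have [s ->] := pres_surj j => c u v; rewrite !chiL_pcls.
  by apply: termact_linear => b x.
apply/eqP => /(congr1 (tlift (fun x j => chiL (chiA x) j))).
have bl j : linear (fun x => chiL (chiA x) j).
  by move=> c x y; rewrite chiA_lin chiL_linl.
rewrite (tlift_pureE bl (fun x => chiL_linr (chiA x))).
rewrite (linf0 (tlift_linear bl (fun x => chiL_linr (chiA x)))).
have -> : chiA 1 = 1 by rewrite -[1 in LHS]scale1r -pcls_Scal chiA_pcls /= scale1r.
have -> : chiL 1 1 = 1.
  by rewrite -[X in chiL _ X]scale1r -pcls_Scal chiL_pcls /= scale1r.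
by move=> /eqP; rewrite oner_eq0.
Qed.

HB.instance Definition _ := GRing.Zmodule_isNzRing.Build twisted
  tw_mulA tw_mul1l tw_mul1r tw_mulDl tw_mulDr tw_one_neq0.

Fact tw_scaleAl (c : R[i]) (s t : twisted) : c *: (s * t) = (c *: s) * t.
Proof. by rewrite [RHS](linfZ (tw_mul_linl t)). Qed.
HB.instance Definition _ :=
  GRing.Lmodule_isLalgebra.Build R[i] twisted tw_scaleAl.

Fact tw_scaleAr (c : R[i]) (s t : twisted) : c *: (s * t) = s * (c *: t).
Proof. by rewrite [RHS](linfZ (tw_mul_linr s)). Qed.
HB.instance Definition _ :=
  GRing.Lalgebra_isAlgebra.Build R[i] twisted tw_scaleAr.

Let k_real n : (k ^ n)^* = k ^ n.
Proof.
by case: n => n; rewrite /exprz ?conjc_inv; [|congr (_^-1)];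
  rewrite rmorphXn /= conjc_real.
Qed.

Let tw_starZk n s : tw_star (k ^ n *: s) = k ^ n *: tw_star s.
Proof. by rewrite tw_starZ; congr (_ *: _); apply: k_real. Qed.

Let tw_star0 : tw_star 0 = 0.
Proof. by apply: (@addrI _ (tw_star 0)); rewrite -tw_starD !addr0. Qed.

Fact tw_starM (s t : twisted) : tw_star (s * t) = tw_star t * tw_star s.
Proof.
elim: (twisted_span s) => [|z {}s s' Ss _ IH].
  by rewrite mul0r tw_star0 mulr0.
rewrite mulrDl !tw_starD mulrDr -IH -scalerAl !tw_starZ -scalerAr.
congr (_ *: _ + _) => {z s' IH}.
elim: (twisted_span t) => [|z {}t t' St _ IH].
  by rewrite mulr0 tw_star0 mul0r.
rewrite mulrDr !tw_starD mulrDl -IH -scalerAr !tw_starZ -scalerAl.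
congr (_ *: _ + _) => {z t' IH}.
case: Ss St => [a [b [c [d [n ->]]]]] [a' [b' [c' [d' [n' ->]]]]].
have mE (u v : twisted) : u * v = tw_mul u v by [].
rewrite !mE !(tw_mul_mon, tw_starZk, tw_star_mon, tw_mulZl, tw_mulZr).
rewrite !scalerA -!expfzDr ?k0 //.
rewrite ![(_ + b)%N]addnC ![(_ + a)%N]addnC ![(_ + d)%N]addnC ![(_ + c)%N]addnC.
rewrite [n' + n]addrC; congr (_ ^ _ *: _).
by rewrite !degD ![deg b _ _ _]degN ![deg b' _ _ _]degN; ring.
Qed.

Fact tw_starK (s : twisted) : tw_star (tw_star s) = s.
Proof.
elim: (twisted_span s) => [|z {}s s' Ss _ IH]; first by rewrite !tw_star0.
rewrite !tw_starD IH !tw_starZ; congr (_ *: _ + _); first exact: conjcK.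
case: Ss => [a [b [c [d [n ->]]]]].
rewrite tw_star_mon tw_starZk tw_star_mon scalerA -expfzDr ?k0 //.
by rewrite [deg b _ _ _]degN mulrN addNr expr0z scale1r.
Qed.

HB.instance Definition _ := Algebra_isStarAlgebra.Build R twisted
  tw_starD tw_starZ tw_starM tw_starK.

End TwistedProduct.

(* The values prescribed for f_SN; those on beta_13 and beta_14 follow from
   compatibility with the involutions. *)
Definition is_fSN (R : realType) (q : {posnum R})
    (f : {lrmorphism SNR4 q -> twistedProduct q}) : Prop :=
  [/\ star_preserving f,
      f (beta q B23) = pure (x23 R) (laurent_r R),
      f (beta q B24) = pure (x24 R) (laurent_r R) &
      f (beta q Rinv) = pure (1 : ASU2 R) (laurent_rinv R)].

(* Main.v *)
Require Import Defs.
From HB Require Import structures.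
From mathcomp Require Import all_boot all_order all_algebra.
From mathcomp Require Import reals interval_inference complex.

(** Both algebras are determined by what the morphisms out of them are, and
    the inverse of f_SN is built from these two universal properties.

    A star-morphism out of a presented algebra is a choice of images of the
    generators that satisfies the relations ([presented_lift]), and it is
    determined by these images ([presented_hom_ext]).  For f_SN, the relations
    beta_24^* = q^-1 beta_13 and beta_23^* = - q^-1 beta_14 force
    beta_13 |-> x24^* ⊗ r and beta_14 |-> - x23^* ⊗ r.  With these values, the
    commutation relations follow from a grading: give x23 and x24 degree 1 and
    their adjoints degree -1; then moving r^m past an element of degree e costs
    q^(m e) ([rpure_qcomm]).  The determinant relation becomes the sphere
    relation x23^* x23 + x24^* x24 = 1.  This gives f_SN ([SNR4_to_twisted]).

    A star-morphism out of the twisted product is a pair of star-morphisms phi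
    on A(SU(2)) and psi on the Laurent algebra with
    psi r * phi x = q phi x * psi r for x = x23, x24 ([twisted_lift]): the
    linear map x ⊗ j |-> phi x * psi j sends Psi (j ⊗ x) to psi j * phi x,
    because this holds on monomials, and the product and the involution of the
    twisted product are defined through Psi.  In the source algebra the
    determinant relation makes r^-1 invertible with self-adjoint inverse
    r = q^-1 r^-1 (beta_13 beta_24 - beta_14 beta_23), which defines psi
    ([Laurent_to_SNR4]), and x23 = beta_23 r^-1, x24 = beta_24 r^-1 commute with
    each other and with their adjoints and satisfy the sphere relation, which
    defines phi ([SU2_to_SNR4]).

    The resulting g is inverse to f_SN, since f_SN (phi x) = x ⊗ 1 and
    f_SN (psi j) = 1 ⊗ j, while g (f_SN beta) = beta for each generator. *)

Set Implicit Arguments.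
Unset Strict Implicit.
Unset Printing Implicit Defensive.

Import Order.TTheory GRing.Theory Num.Theory.

Local Open Scope ring_scope.
Local Open Scope complex_scope.

(** * Star-morphisms out of a presented star-algebra *)

Section TermEval.
Variables (R : realType) (X : Type) (B : starAlgType R) (h : X -> B).

Fixpoint term_eval (t : starTerm R X) : B :=
  match t with
  | Gen x => h x
  | Scal c => c%:A
  | Add s t => term_eval s + term_eval t
  | Mul s t => term_eval s * term_eval t
  | Star t => star (term_eval t)
  end.

Lemma term_eval_congr (rel : starTerm R X -> starTerm R X -> Prop) :
  (forall s t, rel s t -> term_eval s = term_eval t) ->
  forall s t, star_congr rel s t -> term_eval s = term_eval t.
Proof.
move=> relP s t; elim=> {s t} //=.
- by move=> s t u _ -> _ ->.
- by move=> s s' t t' _ -> _ ->.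
- by move=> s s' t t' _ -> _ ->.
- by move=> s s' _ ->.
- by move=> *; apply: addrA.
- by move=> *; apply: addrC.
- by move=> t; rewrite scale0r add0r.
- by move=> t; rewrite mulr_algl scaleN1r subrr scale0r.
- by move=> *; apply: mulrA.
- by move=> t; rewrite scale1r mul1r.
- by move=> *; apply: mulrDl.
- by move=> *; apply: mulrDr.
- by move=> c d; rewrite scalerDl.
- by move=> c d; rewrite mulr_algl scalerA.
- by move=> c t; rewrite mulr_algl mulr_algr.
- by move=> *; apply: starD.
- by move=> *; apply: starM.
- by move=> c; rewrite starZ star1.
- by move=> *; apply: starK.
Qed.

(** Commutation has to be known against the generators and their adjoints: the
    elements that commute with both form a star-subalgebra, so it propagates
    first to one factor and then to the other. *)
Lemma term_eval_comm :
  (forall x y, GRing.comm (h x) (h y)) ->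
  (forall x y, GRing.comm (h x) (star (h y))) ->
  forall s t, GRing.comm (term_eval s) (term_eval t).
Proof.
move=> hC hsC.
have starC a b : GRing.comm a b -> GRing.comm (star a) (star b).
  by move=> ab; rewrite /GRing.comm -!starM ab.
have gen_comm t : forall x,
    GRing.comm (term_eval t) (h x) /\ GRing.comm (term_eval t) (star (h x)).
  elim: t => [y|c|s Hs t Ht|s Hs t Ht|t Ht] x /=; split=> //.
  - by rewrite /GRing.comm mulr_algl mulr_algr.
  - by rewrite /GRing.comm mulr_algl mulr_algr.
  - by apply/commr_sym/commrD; apply/commr_sym; [case: (Hs x)|case: (Ht x)].
  - by apply/commr_sym/commrD; apply/commr_sym; [case: (Hs x)|case: (Ht x)].
  - by apply/commr_sym/commrM; apply/commr_sym; [case: (Hs x)|case: (Ht x)].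
  - by apply/commr_sym/commrM; apply/commr_sym; [case: (Hs x)|case: (Ht x)].
  - by rewrite -[h x]starK; apply: starC; case: (Ht x).
  - by apply: starC; case: (Ht x).
elim=> [y|c|s Hs s' Hs'|s Hs s' Hs'|s Hs] t /=.
- by apply/commr_sym; case: (gen_comm t y).
- by rewrite /GRing.comm mulr_algl mulr_algr.
- by apply/commr_sym/commrD; apply/commr_sym.
- by apply/commr_sym/commrM; apply/commr_sym.
- by rewrite -[term_eval t]starK; apply: starC; apply: (Hs (Star t)).
Qed.
End TermEval.

Section UniversalProperty.
Variables (R : realType) (P : presentation R) (B : starAlgType R).

(** The morphism evaluates a chosen representative; [term_eval_congr] makes the
    choice irrelevant. *)
Lemma presented_lift (h : generator P -> B) :
  (forall s t, @relation R P s t -> term_eval h s = term_eval h t) ->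
  exists f : {lrmorphism presented P -> B},
    star_preserving f /\ forall x, f (pgen x) = h x.
Proof.
move=> /term_eval_congr evalP.
pose f (x : presented P) : B := term_eval h (repr x).
have fE t : f (pcls t) = term_eval h t by exact/evalP/repr_pcls.
have f_mul : {morph f : x y / x * y}.
  move=> x y; have [s ->] := pres_surj x; have [t ->] := pres_surj y.
  by rewrite -pcls_Mul !fE.
have f_scal c : f c%:A = c%:A by rewrite -pcls_Scal fE.
have f_lin : linear f.
  move=> c x y; rewrite -mulr_algl -[in RHS]mulr_algl -f_scal -f_mul.
  move: (_ * x) => {}x.
  have [s ->] := pres_surj x; have [t ->] := pres_surj y.
  by rewrite -pcls_Add !fE.
have f_mon : monoid_morphism f.
  by split=> //; rewrite -[1]scale1r f_scal scale1r.
pose fL := GRing.isLinear.Build R[i] (presented P) B *:%R f f_lin.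
pose fM := GRing.isMonoidMorphism.Build (presented P) B f f_mon.
pose F : {lrmorphism presented P -> B} := HB.pack f fL fM.
exists F; split=> [x|x]; last by rewrite -[LHS]/(f _) -pcls_Gen fE.
by have [t ->] := pres_surj x; rewrite -pcls_Star -![F _]/(f _) !fE.
Qed.

(** The images of the generators suffice because star-preservation takes care of
    their adjoints. *)
Lemma presented_hom_ext (f g : {lrmorphism presented P -> B}) :
  star_preserving f -> star_preserving g ->
  (forall x, f (pgen x) = g (pgen x)) -> f =1 g.
Proof.
move=> fS gS fg; elim/presented_ind => [//|c|x y Hx Hy|x y Hx Hy|x Hx].
- by rewrite !linearZ !rmorph1.
- by rewrite !rmorphD /= Hx Hy.
- by rewrite !rmorphM /= Hx Hy.
- by rewrite fS gS Hx.
Qed.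

End UniversalProperty.

(** * Commutation up to a scalar *)

Section QCommutation.
Variables (R : realType) (B : starAlgType R).
Implicit Types (c d : R[i]) (u v w : B).

Definition qcomm c u v := u * v = c *: (v * u).

Lemma qcomm1l v : qcomm 1 1 v.
Proof. by rewrite /qcomm mul1r mulr1 scale1r. Qed.

Lemma qcomm1r u : qcomm 1 u 1.
Proof. by rewrite /qcomm mul1r mulr1 scale1r. Qed.

Lemma qcommMl c d u v w : qcomm c u w -> qcomm d v w -> qcomm (c * d) (u * v) w.
Proof.
move=> uw vw; rewrite /qcomm -mulrA vw -scalerAr [u * (w * v)]mulrA uw.
by rewrite -scalerAl scalerA mulrC -mulrA.
Qed.

Lemma qcommMr c d u v w : qcomm c u v -> qcomm d u w -> qcomm (c * d) u (v * w).
Proof.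
move=> uv uw; rewrite /qcomm [u * (v * w)]mulrA uv -scalerAl -[v * u * w]mulrA uw.
by rewrite -scalerAr scalerA mulrA.
Qed.

Lemma qcommXl c u v n : qcomm c u v -> qcomm (c ^+ n) (u ^+ n) v.
Proof.
move=> uv; elim: n => [|n IHn]; first exact: qcomm1l.
by rewrite !exprS; apply: qcommMl.
Qed.

Lemma qcommXr c u v n : qcomm c u v -> qcomm (c ^+ n) u (v ^+ n).
Proof.
move=> uv; elim: n => [|n IHn]; first exact: qcomm1r.
by rewrite !exprS; apply: qcommMr.
Qed.

Lemma qcomm_sym c u v : c != 0 -> qcomm c u v -> qcomm c^-1 v u.
Proof. by move=> c0 uv; rewrite /qcomm uv scalerA mulVf // scale1r. Qed.

Lemma qcommVl c u u' v : c != 0 -> u * u' = 1 -> u' * u = 1 ->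
  qcomm c u v -> qcomm c^-1 u' v.
Proof.
move=> c0 uu' u'u uv; rewrite /qcomm.
have -> : v * u' = u' * (u * v) * u' by rewrite mulrA u'u mul1r.
by rewrite uv -scalerAr -scalerAl scalerA mulVf // scale1r -!mulrA uu' mulr1.
Qed.

(** Taking adjoints reverses both sides, so the scalar is inverted; this is why
    x23^* and x24^* have degree opposite to that of x23 and x24. *)
Lemma qcomm_star c u v : c != 0 -> (c^*)%R = c -> star u = u ->
  qcomm c u v -> qcomm c^-1 u (star v).
Proof.
move=> c0 cr us uv; apply: qcomm_sym => //.
by rewrite /qcomm -[in LHS]us -starM uv starZ cr starM us.
Qed.
End QCommutation.

(** * Star-morphisms out of the twisted product *)

Section TwistedProductTheory.
Variables (R : realType) (q : {posnum R}).
Local Notation A := (ASU2 R).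
Local Notation L := (Laurent R).
Local Notation twisted := (twistedProduct q).
Local Notation k := ((q%:num)%:C).
Let k0 : k != 0 := posnumC_neq0 q.

(** The type ascription makes products and adjoints of pure tensors those of the
    twisted product. *)
Definition tw_pure (x : A) (j : L) : twisted := pure x j.

Lemma mul_pureE (x : A) (j : L) a i :
  @mul_pure R q x j (pure a i) = tw_pure (x * a) (i * j).
Proof.
apply: tlift_pureE => [v c u w|u c v w].
- by rewrite mulrDr -scalerAr pure_linl.
- by rewrite mulrDl -scalerAl pure_linr.
Qed.

Lemma mul_pure_linear (x : A) (j : L) : linear (@mul_pure R q x j).
Proof.
apply: tlift_linear => [v c u w|u c v w].
- by rewrite mulrDr -scalerAr pure_linl.
- by rewrite mulrDl -scalerAl pure_linr.
Qed.

Lemma rpow0 : rpow R 0 = 1.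
Proof. by []. Qed.

Lemma mon0 : mon R 0 0 0 0 = 1.
Proof. by rewrite /mon !expr0 !mulr1. Qed.

Lemma Psi_1l (y : A) : Psi q (pure 1 y) = pure y 1.
Proof.
apply: (linear_lspan (f := fun y => Psi q (pure 1 y)) (g := fun y : A => pure y 1)
  _ _ _ (ASU2_span y)).
- by move=> c u v; rewrite pure_linr Psi_linear.
- exact: pure_linl.
- move=> _ [a [b [c [d ->]]]].
  by rewrite -rpow0 Psi_rpow mul0r expr0z scale1r.
Qed.

Lemma Psi_1r (j : L) : Psi q (pure j 1) = pure 1 j.
Proof.
apply: (linear_lspan (f := fun j => Psi q (pure j 1)) (g := fun j : L => pure 1 j)
  _ _ _ (Laurent_span j)).
- by move=> c u v; rewrite pure_linl Psi_linear.
- exact: pure_linr.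
- by move=> _ [n ->]; rewrite -mon0 Psi_rpow subrr mulr0 expr0z scale1r.
Qed.

Lemma tw_pureM x i y j :
  tw_pure x i * tw_pure y j = @mul_pure R q x j (Psi q (pure i y)).
Proof. exact: tw_mulE. Qed.

Lemma tw_pureMl x y j : tw_pure x 1 * tw_pure y j = tw_pure (x * y) j.
Proof. by rewrite tw_pureM Psi_1l mul_pureE mul1r. Qed.

Lemma tw_pureMr x i j : tw_pure x i * tw_pure 1 j = tw_pure x (i * j).
Proof. by rewrite tw_pureM Psi_1r mul_pureE mulr1. Qed.

Lemma star_tw_pure x j : star (tw_pure x j) = Psi q (pure (star j) (star x)).
Proof. exact: tw_starE. Qed.

Lemma conj_kX (n : int) : ((k ^ n)^*)%R = k ^ n.
Proof.
rewrite -[LHS]/((k ^ n)^* )%C.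
by case: n => n; rewrite /exprz ?conjc_inv; [|congr (_^-1)];
  rewrite rmorphXn [X in X ^+ _]conjc_real.
Qed.

Section Lift.
Variables (B : starAlgType R).
Variables (phi : {lrmorphism A -> B}) (psi : {lrmorphism L -> B}).
Hypotheses (phi_star : star_preserving phi) (psi_star : star_preserving psi).
Hypothesis comm23 : qcomm k (psi (laurent_r R)) (phi (x23 R)).
Hypothesis comm24 : qcomm k (psi (laurent_r R)) (phi (x24 R)).

Let psi_rpow n : star (psi (rpow R n)) = psi (rpow R n).
Proof. by rewrite -psi_star star_rpow. Qed.

(* For n < 0, the relation with r^-1 follows from the one with r. *)
Let comm_rpow v n : qcomm k (psi (laurent_r R)) v -> qcomm (k ^ n) (psi (rpow R n)) v.
Proof.
move=> rv; case: n => n; first by rewrite /= rmorphXn /=; apply: qcommXl.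
rewrite /= rmorphXn /= NegzE -exprz_inv; apply: qcommXl.
by apply: (qcommVl k0 _ _ rv); rewrite -rmorphM ?r_rinv ?[_ * laurent_r R]mulrC
  ?r_rinv rmorph1.
Qed.

(* The scalar is the one in the value of Psi on r^n and a monomial. *)
Let comm_mon n a b c d :
  qcomm (k ^ (n * ((a + c)%N%:Z - (b + d)%N%:Z)))
    (psi (rpow R n)) (phi (mon R a b c d)).
Proof.
have kn0 : k ^ n != 0 by rewrite expfz_neq0.
have [c23 c24] := (comm_rpow n comm23, comm_rpow n comm24).
have sc v := @qcomm_star _ _ (k ^ n) _ v kn0 (conj_kX n) (psi_rpow n).
have -> : k ^ (n * ((a + c)%N%:Z - (b + d)%N%:Z)) =
    (k ^ n) ^+ a * (k ^ n)^-1 ^+ b * (k ^ n) ^+ c * (k ^ n)^-1 ^+ d.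
  rewrite -exprz_exp; move: (k ^ n) kn0 => l l0.
  rewrite expfzDr // -invr_expz -!exprnP !exprVn !exprD invfM.
  by rewrite -!mulrA; congr (_ * _); rewrite mulrCA.
rewrite /mon !rmorphM !rmorphXn /= !phi_star.
by do !apply: qcommMr; apply: qcommXr => //; apply: sc.
Qed.

Let G : twisted -> B := tlift (fun x j => phi x * psi j).

Let Gl (j : L) : linear (fun x => phi x * psi j).
Proof. by move=> c x y; rewrite linearP mulrDl -scalerAl. Qed.
Let Gr (x : A) : linear (fun j => phi x * psi j).
Proof. by move=> c i j; rewrite linearP mulrDr -scalerAr. Qed.

Let G_pure x j : G (pure x j) = phi x * psi j.
Proof. exact: (tlift_pureE Gl Gr). Qed.
Let G_linear : linear G.
Proof. exact: (tlift_linear Gl Gr). Qed.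

(* Both sides are bilinear in j and x, so powers of r and monomials suffice. *)
Let G_Psi j x : G (Psi q (pure j x)) = psi j * phi x.
Proof.
apply: (linear_lspan (f := fun j => G (Psi q (pure j x)))
  (g := fun j => psi j * phi x) _ _ _ (Laurent_span j)).
- by move=> c u v; rewrite pure_linl Psi_linear G_linear.
- by move=> c u v; rewrite linearP mulrDl -scalerAl.
move=> _ [n ->].
apply: (linear_lspan (f := fun x => G (Psi q (pure (rpow R n) x)))
  (g := fun x => psi (rpow R n) * phi x) _ _ _ (ASU2_span x)).
- by move=> c u v; rewrite pure_linr Psi_linear G_linear.
- by move=> c u v; rewrite linearP mulrDr -scalerAr.
by move=> _ [a [b [c [d ->]]]]; rewrite Psi_rpow (linfZ G_linear) G_pure comm_mon.
Qed.

Let G_mul_pure x j t : G (@mul_pure R q x j t) = phi x * G t * psi j.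
Proof.
apply: (tensor_eq (f := fun t => G (@mul_pure R q x j t))
  (g := fun t => phi x * G t * psi j)).
- by move=> c u v; rewrite mul_pure_linear G_linear.
- by move=> c u v; rewrite G_linear mulrDr mulrDl -scalerAr -scalerAl.
- by move=> a i; rewrite mul_pureE !G_pure !rmorphM !mulrA.
Qed.

Let G_mul : {morph G : s t / s * t}.
Proof.
move=> s t.
apply: (tensor_eq (f := fun s : twisted => G (s * t)) (g := fun s => G s * G t)).
- by move=> c u v; rewrite mulrDl -scalerAl G_linear.
- by move=> c u v; rewrite G_linear mulrDl -scalerAl.
move=> x i.
apply: (tensor_eq (f := fun t : twisted => G (tw_pure x i * t))
  (g := fun t => G (pure x i) * G t)).
- by move=> c u v; rewrite mulrDr -scalerAr G_linear.
- by move=> c u v; rewrite G_linear mulrDr -scalerAr.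
by move=> y j; rewrite tw_pureM G_mul_pure G_Psi !G_pure !mulrA.
Qed.

(** The scalar q for r against x23 and x24 forces those for the adjoints and for
    all powers of r, and these are the scalars in Psi. *)
Lemma twisted_lift : exists g : {lrmorphism twisted -> B},
  star_preserving g /\ forall x j, g (tw_pure x j) = phi x * psi j.
Proof.
have G_mon : monoid_morphism G.
  by split=> //; rewrite -[1]/(pure 1 1) G_pure !rmorph1 mulr1.
pose gL := GRing.isLinear.Build R[i] twisted B *:%R G G_linear.
pose gM := GRing.isMonoidMorphism.Build twisted B G G_mon.
pose g : {lrmorphism twisted -> B} := HB.pack G gL gM.
exists g; split=> [s|x j]; last exact: G_pure.
rewrite -![g _]/(G _); elim/tensor_ind: s => [|x j s IH].
  by rewrite star0 (linf0 G_linear) star0.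
rewrite starD !(linfD G_linear) starD IH; congr (_ + _).
by rewrite -[pure x j]/(tw_pure x j) star_tw_pure G_Psi G_pure starM phi_star psi_star.
Qed.
End Lift.
End TwistedProductTheory.

(** * The relations of the source algebra *)

Section SNR4Theory.
Variables (R : realType) (q : {posnum R}).
Local Notation k := ((q%:num)%:C).
Local Notation b13 := (beta q B13).
Local Notation b14 := (beta q B14).
Local Notation b23 := (beta q B23).
Local Notation b24 := (beta q B24).
Local Notation ri := (beta q Rinv).
Let k0 : k != 0 := posnumC_neq0 q.

(** Stated with [term_eval], so that for each relation it computes to the
    corresponding equation between products of the generators. *)
Lemma SNR4_rel (s t : starTerm R R4_gen) : R4_rel k s t ->
  term_eval (beta q) s = term_eval (beta q) t.
Proof.
have evalE u : term_eval (beta q) u = pcls (P := R4_presentation q) u.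
  by elim: u => [x|c|u Hu v Hv|u Hu v Hv|u Hu]; rewrite pclsE //= ?Hu ?Hv.
by move=> st; rewrite !evalE; apply/pclsP/Congr_rel.
Qed.

Lemma b23_b24 : b23 * b24 = b24 * b23. Proof. exact: SNR4_rel (R4_23_24 _). Qed.
Lemma b13_b23 : qcomm (k ^+ 2) b13 b23.
Proof. by rewrite /qcomm -mulr_algl; apply: SNR4_rel (R4_13_23 _). Qed.
Lemma b13_b24 : qcomm (k ^+ 2) b13 b24.
Proof. by rewrite /qcomm -mulr_algl; apply: SNR4_rel (R4_13_24 _). Qed.
Lemma b14_b23 : qcomm (k ^+ 2) b14 b23.
Proof. by rewrite /qcomm -mulr_algl; apply: SNR4_rel (R4_14_23 _). Qed.
Lemma b14_b24 : qcomm (k ^+ 2) b14 b24.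
Proof. by rewrite /qcomm -mulr_algl; apply: SNR4_rel (R4_14_24 _). Qed.
Lemma b13_ri : qcomm k^-1 b13 ri.
Proof. by rewrite /qcomm -mulr_algl; apply: SNR4_rel (R4_13_r _). Qed.
Lemma b14_ri : qcomm k^-1 b14 ri.
Proof. by rewrite /qcomm -mulr_algl; apply: SNR4_rel (R4_14_r _). Qed.
Lemma b23_ri : qcomm k b23 ri.
Proof. by rewrite /qcomm -mulr_algl; apply: SNR4_rel (R4_23_r _). Qed.
Lemma b24_ri : qcomm k b24 ri.
Proof. by rewrite /qcomm -mulr_algl; apply: SNR4_rel (R4_24_r _). Qed.
Lemma star_b24 : star b24 = k^-1 *: b13.
Proof. by rewrite -mulr_algl; apply: SNR4_rel (R4_star24 _). Qed.
Lemma star_b23 : star b23 = - k^-1 *: b14.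
Proof. by rewrite -mulr_algl; apply: SNR4_rel (R4_star23 _). Qed.
Lemma star_ri : star ri = ri.
Proof. exact: SNR4_rel (R4_starr _). Qed.

Definition SNR4_det : SNR4 q := b13 * b24 - b14 * b23.

Lemma ri_detl : ri * ri * SNR4_det = k%:A.
Proof. by have := SNR4_rel (R4_detl k); rewrite /= scaleN1r mulNr mul1r. Qed.
Lemma ri_detr : SNR4_det * (ri * ri) = k%:A.
Proof. by have := SNR4_rel (R4_detr k); rewrite /= scaleN1r mulNr mul1r. Qed.

(** The element r of the source algebra, solved from the determinant relation. *)
Definition SNR4_r : SNR4 q := k^-1 *: (ri * SNR4_det).

Lemma ri_r : ri * SNR4_r = 1.
Proof. by rewrite -scalerAr mulrA ri_detl scalerA mulVf // scale1r. Qed.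

(** The left and the right inverse of r^-1 that the two halves of the determinant
    relation provide coincide. *)
Lemma r_ri : SNR4_r * ri = 1.
Proof.
pose r' : SNR4 q := k^-1 *: (SNR4_det * ri).
have r'ri : r' * ri = 1 by rewrite -scalerAl -mulrA ri_detr scalerA mulVf // scale1r.
suff -> : SNR4_r = r' by [].
by rewrite -[LHS]mul1r -r'ri -mulrA ri_r mulr1.
Qed.

(** The inverse of a self-adjoint element is self-adjoint. *)
Lemma star_SNR4_r : star SNR4_r = SNR4_r.
Proof.
have sr : star SNR4_r * ri = 1 by rewrite -[X in _ * X]star_ri -starM ri_r star1.
by rewrite -[LHS]mulr1 -ri_r mulrA sr mul1r.
Qed.

(** * A(SU(2)) and the Laurent algebra in the source algebra *)

Definition SNR4_x (x : SU2_gen) : SNR4 q :=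
  match x with X23 => b23 * ri | X24 => b24 * ri end.

Lemma star_SNR4_x23 : star (SNR4_x X23) = - (b14 * ri).
Proof.
by rewrite starM star_ri star_b23 b14_ri -scalerAr scaleNr.
Qed.

Lemma star_SNR4_x24 : star (SNR4_x X24) = b13 * ri.
Proof. by rewrite starM star_ri star_b24 b13_ri -scalerAr. Qed.

(** Collecting the two factors r^-1 on the right costs d^-1 in u r^-1 v r^-1 and
    c^-1 in v r^-1 u r^-1; the two products agree since e = d / c. *)
Lemma comm_mul_ri c d e u v : c != 0 -> d != 0 -> qcomm c u ri -> qcomm d v ri ->
  qcomm e u v -> d = c * e -> GRing.comm (u * ri) (v * ri).
Proof.
move=> c0 d0 uri vri uv cde.
have riu : ri * u = c^-1 *: (u * ri) := qcomm_sym c0 uri.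
have riv : ri * v = d^-1 *: (v * ri) := qcomm_sym d0 vri.
rewrite /GRing.comm -mulrA (mulrA ri) riv -[RHS]mulrA (mulrA ri) riu.
rewrite -!scalerAl -!scalerAr !mulrA uv -!scalerAl scalerA.
have e0 : e != 0 by apply: contraNneq d0 => e0; rewrite cde e0 mulr0.
by congr (_ *: _); rewrite cde invfM -mulrA mulVf // mulr1.
Qed.

Lemma SNR4_x_comm x y : GRing.comm (SNR4_x x) (SNR4_x y).
Proof.
have cc b b' : GRing.comm b b' -> qcomm k b ri -> qcomm k b' ri ->
    GRing.comm (b * ri) (b' * ri).
  move=> bb' br b'r; apply: (comm_mul_ri (e := 1) k0 k0 br b'r); last by rewrite mulr1.
  by rewrite /qcomm scale1r.
case: x y => -[] /=; apply: cc; try exact: b23_ri; try exact: b24_ri.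
- by [].
- exact: b23_b24.
- exact/commr_sym/b23_b24.
- by [].
Qed.

Lemma SNR4_x_comm_star x y : GRing.comm (SNR4_x x) (star (SNR4_x y)).
Proof.
have kV0 : k^-1 != 0 by rewrite invr_eq0.
(* beta_13, beta_14 have weight k^-1 and beta_23, beta_24 have weight k against
   r^-1, and the relations between them have e = k^2. *)
have kk : k = k^-1 * k ^+ 2 by rewrite expr2 mulrA mulVf // mul1r.
case: x y => -[]; rewrite ?(star_SNR4_x23, star_SNR4_x24);
  first [apply: commrN|idtac]; apply/commr_sym.
- exact: comm_mul_ri kV0 k0 b14_ri b23_ri b14_b23 kk.
- exact: comm_mul_ri kV0 k0 b13_ri b23_ri b13_b23 kk.
- exact: comm_mul_ri kV0 k0 b14_ri b24_ri b14_b24 kk.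
- exact: comm_mul_ri kV0 k0 b13_ri b24_ri b13_b24 kk.
Qed.

(** Moving the inner factors r^-1 to the right turns this into the determinant
    relation. *)
Lemma SNR4_x_sphere : star (SNR4_x X23) * SNR4_x X23 + star (SNR4_x X24) * SNR4_x X24 = 1.
Proof.
have riu u : qcomm k u ri -> ri * u = k^-1 *: (u * ri) by apply: qcomm_sym.
rewrite star_SNR4_x23 star_SNR4_x24 /= mulNr -!mulrA !(mulrA ri).
rewrite (riu _ b23_ri) (riu _ b24_ri) -!scalerAl -!scalerAr addrC -scalerBr.
by rewrite !mulrA -!mulrBl -mulrA ri_detr scalerA mulVf // scale1r.
Qed.

(** The hypothesis of [twisted_lift]: r^-1 has weight k^-1 against beta_23 and
    beta_24 and commutes with itself, so r has weight k. *)
Lemma SNR4_r_qcomm_x x : qcomm k SNR4_r (SNR4_x x).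
Proof.
have kV0 : k^-1 != 0 by rewrite invr_eq0.
rewrite -[k]invrK; apply: (qcommVl kV0 ri_r r_ri).
by rewrite -[k^-1]mulr1; case: x; apply: qcommMr; do ?[exact: qcomm_sym k0 b23_ri
  |exact: qcomm_sym k0 (b24_ri)|by rewrite /qcomm scale1r].
Qed.

Lemma SU2_to_SNR4 : exists phi : {lrmorphism ASU2 R -> SNR4 q},
  star_preserving phi /\ forall x, phi (pgen (P := SU2_presentation R) x) = SNR4_x x.
Proof.
apply: (presented_lift (P := SU2_presentation R) (B := SNR4 q) (h := SNR4_x)).
move=> s t; case=> {s t} [s t|] /=; last by rewrite scale1r SNR4_x_sphere.
exact: (term_eval_comm SNR4_x_comm SNR4_x_comm_star).
Qed.

Definition SNR4_laurent (x : Laurent_gen) : SNR4 q :=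
  match x with Rp => SNR4_r | Rm => ri end.

Lemma Laurent_to_SNR4 : exists psi : {lrmorphism Laurent R -> SNR4 q},
  star_preserving psi /\
  forall x, psi (pgen (P := Laurent_presentation R) x) = SNR4_laurent x.
Proof.
have hC x y : GRing.comm (SNR4_laurent x) (SNR4_laurent y).
  by case: x y => -[]; rewrite /GRing.comm //= ri_r r_ri.
have hs x : star (SNR4_laurent x) = SNR4_laurent x.
  by case: x; [exact: star_SNR4_r|exact: star_ri].
apply: (presented_lift (P := Laurent_presentation R) (B := SNR4 q)
  (h := SNR4_laurent)).
move=> s t; case=> {s t} [s t|||] /=.
- by apply: term_eval_comm => x y; rewrite ?hs.
- by rewrite scale1r r_ri.
- by rewrite scale1r ri_r.
- exact: star_SNR4_r.
Qed.

(** * The generators in the twisted product *)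

(** Homogeneity of degree e for the grading of A(SU(2)) that the twist sees. *)
Definition tw_deg (e : int) (y : ASU2 R) := forall m,
  Psi q (pure (rpow R m) y) = k ^ (m * e) *: pure y (rpow R m).

Lemma tw_deg_mon a b c d : tw_deg ((a + c)%N%:Z - (b + d)%N%:Z) (mon R a b c d).
Proof. by move=> m; apply: Psi_rpow. Qed.

Lemma tw_deg_x23 : tw_deg 1 (x23 R).
Proof. by have := tw_deg_mon 1 0 0 0; rewrite /mon expr1 !expr0 !mulr1. Qed.
Lemma tw_deg_x24 : tw_deg 1 (x24 R).
Proof. by have := tw_deg_mon 0 0 1 0; rewrite /mon expr1 !expr0 !mulr1 !mul1r. Qed.
Lemma tw_deg_star_x23 : tw_deg (-1) (star (x23 R)).
Proof. by have := tw_deg_mon 0 1 0 0; rewrite /mon expr1 !expr0 !mulr1 !mul1r. Qed.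
Lemma tw_deg_star_x24 : tw_deg (-1) (star (x24 R)).
Proof. by have := tw_deg_mon 0 0 0 1; rewrite /mon expr1 !expr0 !mul1r. Qed.

Lemma tw_deg1 : tw_deg 0 1.
Proof. by have := tw_deg_mon 0 0 0 0; rewrite mon0. Qed.

Definition rpure (x : ASU2 R) n := tw_pure q x (rpow R n).

Lemma rpureM e x m y n : tw_deg e y ->
  rpure x m * rpure y n = k ^ (m * e) *: rpure (x * y) (m + n).
Proof.
move=> ye; rewrite /rpure tw_pureM ye (linfZ (mul_pure_linear _ _)) mul_pureE.
by rewrite -rpowD.
Qed.

Lemma star_rpure e x n : tw_deg e (star x) ->
  star (rpure x n) = k ^ (n * e) *: rpure (star x) n.
Proof. by move=> xe; rewrite star_tw_pure star_rpow xe. Qed.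

(** Up to order, both products are the same pure tensor; forming them costs
    k^(m e') and k^(n e). *)
Lemma rpure_qcomm e x m e' y n : tw_deg e x -> tw_deg e' y ->
  qcomm (k ^ (m * e' - n * e)) (rpure x m) (rpure y n).
Proof.
move=> xe ye; rewrite /qcomm (rpureM _ _ _ xe) (rpureM _ _ _ ye) scalerA.
by rewrite -expfzDr // subrK [x * y]mulrC [m + n]addrC.
Qed.

(** The values at beta_13 and beta_14 are forced: (x24 ⊗ r)^* is q^-1 x24^* ⊗ r,
    and it has to be the image of beta_24^* = q^-1 beta_13; similarly for beta_14,
    with the sign of beta_23^* = - q^-1 beta_14. *)
Definition fSN_gen (x : R4_gen) : twistedProduct q :=
  match x with
  | B13 => rpure (star (x24 R)) 1
  | B14 => - rpure (star (x23 R)) 1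
  | B23 => rpure (x23 R) 1
  | B24 => rpure (x24 R) 1
  | Rinv => rpure 1 (-1)
  end.

Lemma SNR4_to_twisted : exists f : {lrmorphism SNR4 q -> twistedProduct q},
  star_preserving f /\ forall x, f (beta q x) = fSN_gen x.
Proof.
apply: (presented_lift (P := R4_presentation q) (B := twistedProduct q)
  (h := fSN_gen)).
have [c23 c24] := (tw_deg_x23, tw_deg_x24).
have [s23 s24] := (tw_deg_star_x23, tw_deg_star_x24).
have c1 := tw_deg1.
(* The twist contributes the same factor k to both terms of the determinant,
   which leaves the sphere relation. *)
have det : rpure (star (x24 R)) 1 * rpure (x24 R) 1 +
    rpure (star (x23 R)) 1 * rpure (x23 R) 1 = k *: rpure 1 2.
  rewrite (rpureM _ _ _ c24) (rpureM _ _ _ c23) -scalerDr mul1r expr1z.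
  by rewrite /rpure /tw_pure -pureDl addrC sphere.
have ri2 : rpure 1 (-1) * rpure 1 (-1) = rpure 1 (-2).
  by rewrite (rpureM _ _ _ c1) mulr0 expr0z scale1r mulr1.
have ri2r2 : rpure 1 (-2) * rpure 1 2 = 1.
  by rewrite (rpureM _ _ _ c1) mulr0 expr0z scale1r mulr1.
have r2ri2 : rpure 1 2 * rpure 1 (-2) = 1.
  by rewrite (rpureM _ _ _ c1) mulr0 expr0z scale1r mulr1.
move=> s t; case=> {s t}; rewrite /= ?mulr_algl ?scaleN1r ?mulNr ?mulrN ?opprK.
- by congr (- _); rewrite (rpure_qcomm 1 1 s24 s23) scale1r.
- by rewrite (rpure_qcomm 1 1 c23 c24) scale1r.
- exact: (rpure_qcomm 1 1 s24 c23).
- exact: (rpure_qcomm 1 1 s24 c24).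
- by rewrite (rpure_qcomm 1 1 s23 c23) scalerN.
- by rewrite (rpure_qcomm 1 1 s23 c24) scalerN.
- exact: (rpure_qcomm 1 (-1) s24 c1).
- by rewrite (rpure_qcomm 1 (-1) s23 c1) scalerN.
- exact: (rpure_qcomm 1 (-1) c23 c1).
- exact: (rpure_qcomm 1 (-1) c24 c1).
- by rewrite ?mul1r ?opprK det ri2 -scalerAr ri2r2.
- by rewrite ?mul1r ?opprK det ri2 -scalerAl r2ri2.
- exact: (star_rpure 1 s24).
- by rewrite scalerN scaleNr opprK; apply: (star_rpure 1 s23).
- by rewrite (star_rpure (e := 0)) star1 // mulr0 expr0z scale1r.
Qed.

(** * The isomorphism *)

(** The generators beta_13 and beta_14 are multiples of adjoints of beta_24 and
    beta_23, so the three prescribed values determine the morphism. *)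
Lemma fSN_ext (f g : {lrmorphism SNR4 q -> twistedProduct q}) :
  is_fSN f -> is_fSN g -> f =1 g.
Proof.
move=> [sf f23 f24 fr] [sg g23 g24 gr].
have b13E : b13 = k *: star b24 by rewrite star_b24 scalerA mulfV // scale1r.
have b14E : b14 = - k *: star b23.
  by rewrite star_b23 scalerA mulrNN mulfV // scale1r.
apply: presented_hom_ext => // x; rewrite -[pgen x]/(beta q x).
by case: x; rewrite ?b13E ?b14E ?linearZ /= ?sf ?sg ?f23 ?f24 ?g23 ?g24 ?fr ?gr.
Qed.
End SNR4Theory.

Theorem proposition3p7 (R : realType) (q : {posnum R}) :
  exists f : {lrmorphism SNR4 q -> twistedProduct q},
    [/\ is_fSN f,
        (forall g : {lrmorphism SNR4 q -> twistedProduct q}, is_fSN g -> g =1 f)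
      & bijective f].
Proof.
have [f [f_star f_beta]] := SNR4_to_twisted q.
have [phi [phi_star phi_x]] := SU2_to_SNR4 q.
have [psi [psi_star psi_r]] := Laurent_to_SNR4 q.
have [g [g_star g_pure]] : exists g : {lrmorphism twistedProduct q -> SNR4 q},
    star_preserving g /\ forall x j, g (tw_pure q x j) = phi x * psi j.
  by apply: twisted_lift => //; rewrite phi_x psi_r; apply: SNR4_r_qcomm_x.
have fSN : is_fSN f by split=> //; rewrite f_beta.
(* f o phi and x |-> x ⊗ 1 agree on x23 and x24, and both respect products and
   adjoints. *)
have fphi x : f (phi x) = tw_pure q x 1.
  have f_x y : f (SNR4_x q y) = tw_pure q (pgen (P := SU2_presentation R) y) 1.
    by case: y; rewrite rmorphM /= !f_beta /= (rpureM _ _ _ (tw_deg1 q)) mulr0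
      expr0z scale1r mulr1.
  elim/presented_ind: x => [y|c|x y Hx Hy|x y Hx Hy|x Hx].
  - by rewrite phi_x f_x.
  - by rewrite !linearZ /= !rmorph1 /tw_pure pureZl.
  - by rewrite !rmorphD /= Hx Hy /tw_pure pureDl.
  - by rewrite !rmorphM /= Hx Hy tw_pureMl.
  - by rewrite phi_star f_star Hx star_tw_pure star1 Psi_1l.
have fpsi j : f (psi j) = tw_pure q 1 j.
  have f_ri : f (beta q Rinv) = tw_pure q 1 (laurent_rinv R).
    by rewrite f_beta.
  (* f r and 1 ⊗ r are both inverse to 1 ⊗ r^-1. *)
  have f_r : f (SNR4_r q) = tw_pure q 1 (laurent_r R).
    have ffr : f (SNR4_r q) * tw_pure q 1 (laurent_rinv R) = 1.
      by rewrite -f_ri -rmorphM r_ri rmorph1.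
    rewrite -[RHS]mul1r -ffr -mulrA tw_pureMr [_ * laurent_r R]mulrC r_rinv.
    by rewrite mulr1.
  elim/presented_ind: j => [y|c|x y Hx Hy|x y Hx Hy|x Hx].
  - by rewrite psi_r; case: y.
  - by rewrite !linearZ /= !rmorph1 /tw_pure pureZr.
  - by rewrite !rmorphD /= Hx Hy /tw_pure pureDr.
  - by rewrite !rmorphM /= Hx Hy tw_pureMr.
  - by rewrite psi_star f_star Hx star_tw_pure star1 Psi_1r.
have gK : cancel g f.
  apply: (tensor_eq (f := f \o g) (g := idfun)).
  - by move=> c s t; rewrite /= !linearP.
  - by [].
  - by move=> x j; rewrite /= g_pure rmorphM /= fphi fpsi tw_pureMl mulr1.
have fK : cancel f g.
  move=> a; rewrite -[LHS]/((g \o f) a) -[RHS]/(idfun a).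
  apply: presented_hom_ext => // [b|x]; first by rewrite /= f_star g_star.
  rewrite -[pgen x]/(beta q x) /= f_beta.
  have sx y : phi (star (pgen (P := SU2_presentation R) y)) = star (SNR4_x q y).
    by rewrite phi_star phi_x.
  have riK u : u * beta q Rinv * SNR4_r q = u by rewrite -mulrA ri_r mulr1.
  case: x => /=; rewrite ?rmorphN /= g_pure ?rmorph1 ?mul1r ?phi_x ?psi_r //=.
  - by rewrite sx star_SNR4_x24 riK.
  - by rewrite sx star_SNR4_x23 mulNr opprK riK.
exists f; split=> //; last by exists g.
by move=> g' /fSN_ext; apply.
Qed.
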